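(* Exactly eighteen subvarieties of $\mathcal V=\mathsf V(R_{12})$ are finitely based. All other subvarieties of $\mathcal V$ are nonfinitely based, and $\mathcal L=\mathsf V(SR_6)=\mathsf V(R_{00})$ is the unique limit subvariety of $\mathcal V$. The varieties generated by $R_{01},R_{02},R_{11}$ have respectively $5,5,18$ finitely based subvarieties, and each of them has the same unique limit subvariety $\mathcal L$.
   Context: Language: two binary operations $+,\cdot$, no constants. $\mathsf V(S)$ is the variety generated by $S$. A variety is finitely based if it is defined by a finite set of identities, and nonfinitely based otherwise. A limit variety is a nonfinitely based variety all of whose proper subvarieties are finitely based; a limit subvariety of $\mathcal W$ is a subvariety of $\mathcal W$ that is a limit variety. Let $M=\{0,c,p,q,a,b\}$ be the commutative semigroup whose only nonzero products are $pb=bp=ab=ba=aq=qa=c$ (all other products, including squares, are $0$). For $i,j\in\{0,1,2\}$, $R_{ij}$ is the commutative additively idempotent semiring on $M$ with this multiplication whose addition is the join operation of the partial order generated by $a<p<0$, $b<q<0$, $c<0$, together with: the first $i$ elements of the chain $a<p$ lie below $c$, and the first $j$ elements of the chain $b<q$ lie below $c$. $SR_6=R_{00}$. *)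

(* Defs.v *)
From HB Require Import structures.
From mathcomp Require Import all_boot.
From mathcomp Require Import boolp classical_sets functions cardinality.

Set Implicit Arguments.
Unset Strict Implicit.
Unset Printing Implicit Defensive.

Local Open Scope classical_set_scope.

Inductive term :=
  | Var of nat
  | Add of term & term
  | Mul of term & term.

Definition identity := (term * term)%type.

(* Algebras are nonempty, as is usual when there are no constants. *)
Record algebra := Algebra {
  carrier :> Type;
  carrier_inhabited : inhabited carrier;
  add : carrier -> carrier -> carrier;
  mul : carrier -> carrier -> carrier }.

Fixpoint eval (A : algebra) (v : nat -> A) (t : term) : A :=
  match t with
  | Var n => v n
  | Add t1 t2 => add (eval v t1) (eval v t2)
  | Mul t1 t2 => mul (eval v t1) (eval v t2)
  end.

Definition satisfies (A : algebra) (e : identity) : Prop :=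
  forall v : nat -> A, eval v e.1 = eval v e.2.

Definition models (E : set identity) : set algebra :=
  [set A | forall e, E e -> satisfies A e].

Definition homomorphism (A B : algebra) (f : A -> B) : Prop :=
  {morph f : x y / add x y} /\ {morph f : x y / mul x y}.

Lemma product_inhabited (I : Type) (F : I -> algebra) :
  inhabited (forall i, F i).
Proof.
have x i : {x : F i | True} by apply: cid; case: (carrier_inhabited (F i)) => x; exists x.
by split=> i; case: (x i).
Qed.

Definition product (I : Type) (F : I -> algebra) : algebra :=
  @Algebra (forall i, F i) (product_inhabited F)
    (fun x y i => add (x i) (y i)) (fun x y i => mul (x i) (y i)).

(* Subalgebras are taken up to isomorphism.  The empty product is allowed, so
   that every variety contains the one-element algebras. *)
Definition is_variety (K : set algebra) : Prop :=
  [/\ forall (A B : algebra) (f : A -> B),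
        homomorphism f -> (forall y, exists x, f x = y) -> K A -> K B,
      forall (A B : algebra) (f : B -> A),
        homomorphism f -> injective f -> K A -> K B &
      forall (I : Type) (F : I -> algebra), (forall i, K (F i)) -> K (product F)].

Definition generated_variety (S : algebra) : set algebra :=
  smallest is_variety [set S].

Definition finitely_based (K : set algebra) : Prop :=
  exists2 E : set identity, finite_set E & K = models E.

Definition subvarieties (K : set algebra) : set (set algebra) :=
  [set W | is_variety W /\ W `<=` K].

Definition limit_variety (K : set algebra) : Prop :=
  [/\ is_variety K, ~ finitely_based K &
      forall W, subvarieties K W -> W `<` K -> finitely_based W].

Definition fb_subvarieties (K : set algebra) : set (set algebra) :=
  [set W | subvarieties K W /\ finitely_based W].

Definition limit_subvarieties (K : set algebra) : set (set algebra) :=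
  [set W | subvarieties K W /\ limit_variety W].

Inductive M := m0 | mc | mp | mq | ma | mb.

Definition M_code (x : M) : 'I_6 :=
  match x with
  | m0 => @Ordinal 6 0 isT | mc => @Ordinal 6 1 isT | mp => @Ordinal 6 2 isT
  | mq => @Ordinal 6 3 isT | ma => @Ordinal 6 4 isT | mb => @Ordinal 6 5 isT
  end.

Definition M_decode (k : 'I_6) : M := nth m0 [:: m0; mc; mp; mq; ma; mb] k.

Lemma M_codeK : cancel M_code M_decode.
Proof. by case. Qed.

HB.instance Definition _ := Countable.copy M (can_type M_codeK).
HB.instance Definition _ : isFinite M := CanIsFinite M_codeK.

Definition M_mul (x y : M) : M :=
  match x, y with
  | mp, mb | mb, mp | ma, mb | mb, ma | ma, mq | mq, ma => mc
  | _, _ => m0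
  end.

Definition M_gen (i j : nat) : rel M := fun x y =>
  match x, y with
  | ma, mp | mp, m0 | mb, mq | mq, m0 | mc, m0 => true
  | ma, mc => 1 <= i
  | mp, mc => 2 <= i
  | mb, mc => 1 <= j
  | mq, mc => 2 <= j
  | _, _ => false
  end.

Definition M_le (i j : nat) : rel M := connect (M_gen i j).

Definition M_is_join (i j : nat) (x y z : M) : bool :=
  [&& M_le i j x z, M_le i j y z &
      [forall w, M_le i j x w && M_le i j y w ==> M_le i j z w]].

Definition M_join (i j : nat) (x y : M) : M :=
  odflt m0 [pick z | M_is_join i j x y z].

Definition R (i j : nat) : algebra :=
  @Algebra M (inhabits m0) (M_join i j) M_mul.

Definition SR6 : algebra := R 0 0.

Lemma M_leE (i j : nat) (x y : M) :
  M_le i j x y = [|| x == y, y == m0 | M_gen i j x y].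
Proof.
apply/idP/idP; last first.
  case/or3P=> [/eqP->|/eqP->|xy]; [exact: connect0| |exact: connect1].
  have mp0 : M_le i j mp m0 by exact: connect1.
  have mq0 : M_le i j mq m0 by exact: connect1.
  case: x => //; try exact: connect1; first exact: connect0.
  - by apply: connect_trans mp0; exact: connect1.
  - by apply: connect_trans mq0; exact: connect1.
case/connectP=> s; elim: s x => [|w s IH] x /=; first by move=> _ ->; rewrite eqxx.
case/andP=> xw ws yE; move: xw (IH _ ws yE) => {IH ws yE}.
by case: x; case: w => //; case: y => //; case: i j => [|[|i]] [|[|j]].
Qed.

Lemma M_le_anti (i j : nat) : antisymmetric (M_le i j).
Proof.
by move=> x y; rewrite !M_leE; case: x; case: y => //; rewrite /= ?andbF.
Qed.

Lemma M_join_exists (i j : nat) (x y : M) : exists z, M_is_join i j x y z.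
Proof.
pose le u v := [|| u == v, v == m0 | M_gen i j u v].
exists (head m0 [seq z <- [:: ma; mb; mp; mq; mc; m0] | le x z && le y z]).
rewrite /M_is_join; apply/and3P; split; last (apply/forallP=> w; apply/implyP).
all: rewrite !M_leE /le {le}.
all: case: i => [|[|i]]; case: j => [|[|j]]; case: x; case: y => //=; by case: w.
Qed.

Lemma M_joinP (i j : nat) (x y z : M) :
  M_le i j (M_join i j x y) z = M_le i j x z && M_le i j y z.
Proof.
rewrite /M_join; case: pickP => [t /and3P[xt yt /forallP tP]|no]; last first.
  by have [t tP] := M_join_exists i j x y; rewrite no in tP.
apply/idP/idP => [tz|]; last exact/implyP.
by rewrite /M_le (connect_trans xt tz) (connect_trans yt tz).
Qed.

(* Main.v *)
From mathcomp Require Import all_boot.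
From mathcomp Require Import boolp classical_sets functions cardinality zify.
Require Import Defs.

(* In the algebras at hand products of three factors and squares are the
   greatest element 0.  Hence an identity is a conjunction of rules "if all
   monomials of T are below u, then so is the monomial m", and an element u only
   matters through the graph {xy <= u} with the marked vertices {x <= u}; T is
   itself a graph with marked vertices, the linear monomials.

   In SR6 every nonedge of a bipartite graph is separated by some assignment, so
   that SR6 satisfies nothing but "T = 0" for T not bipartite, or with a marked
   vertex on an edge.  Odd cycles of unbounded length then show that every
   variety between V(SR6) and V(R_ij) is nonfinitely based.  A rule failing in
   SR6 can be specialized to a path x1 - y2 - x2 - y1, and in V(R_ij) it implies
   that such a path always entails the edge x1 y1.  Modulo this square axiom, all
   components are complete bipartite, and folding the graph of T shows that every
   identity is equivalent to a conjunction of some among ten explicit laws.  The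
   subvarieties without SR6 are thus finitely based, and they correspond to the
   sets of laws closed under a few implications, each one being realized by
   algebras built from a graph with five vertices. *)

Set Implicit Arguments.
Unset Strict Implicit.
Unset Printing Implicit Defensive.

Local Open Scope classical_set_scope.
Local Open Scope card_scope.

(** * Birkhoff's theorem *)

Definition identities (K : set algebra) : set identity :=
  [set e | forall A, K A -> satisfies A e].

Fixpoint rename (f : nat -> nat) (t : term) : term :=
  match t with
  | Var n => Var (f n)
  | Add t1 t2 => Add (rename f t1) (rename f t2)
  | Mul t1 t2 => Mul (rename f t1) (rename f t2)
  end.

Lemma eval_rename (A : algebra) (v : nat -> A) f t :
  eval v (rename f t) = eval (v \o f) t.
Proof. by elim: t => //= t1 -> t2 ->. Qed.

Lemma eq_eval (A : algebra) (v w : nat -> A) t :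
  v =1 w -> eval v t = eval w t.
Proof. by move=> vw; elim: t => //= t1 -> t2 ->. Qed.

Lemma eval_hom (A B : algebra) (f : A -> B) v t :
  homomorphism f -> f (eval v t) = eval (f \o v) t.
Proof. by case=> fD fM; elim: t => //= t1 IH1 t2 IH2; rewrite ?fD ?fM IH1 IH2. Qed.

Lemma eval_product (I : Type) (F : I -> algebra) (v : nat -> product F) t i :
  eval v t i = eval (fun n => v n i) t.
Proof. by elim: t => //= t1 -> t2 ->. Qed.

Lemma models_variety (E : set identity) : is_variety (models E).
Proof.
split=> [A B f fh fs mA e Ee v|A B f fh fi mA e Ee v|I F mF e Ee v].
- pose g y := sval (cid (fs y)).
  have gK y : f (g y) = y by rewrite /g; case: cid.
  have vE : v =1 f \o (g \o v) by move=> n /=; rewrite gK.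
  by rewrite (eq_eval e.1 vE) (eq_eval e.2 vE) -!(eval_hom (g \o v))//;
    congr f; apply: mA.
- by apply: fi; rewrite !eval_hom// (mA e Ee (f \o v)).
- by apply: functional_extensionality_dep => i; rewrite !eval_product (mF i e Ee).
Qed.

(* [A] is a quotient of the subalgebra of a product of members of [K] generated
   by one element [gen a] per element [a] of [A]; the product ranges over
   refutations of all the identities that fail in [K], along all the ways
   [A -> nat] of using their variables. *)
Section Birkhoff.
Variables (K : set algebra) (Kvar : is_variety K) (A : algebra).
Hypothesis (AK : models (identities K) A).

Let refuted := {e : identity | ~ identities K e}.

Let refutation_exists (e : refuted) : exists B : algebra,
  K B /\ exists v : nat -> B, eval v (sval e).1 <> eval v (sval e).2.
Proof.
case: e => e /= eP; apply: contrapT => H; apply: eP => B KB v.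
by apply: contrapT => nE; apply: H; exists B; split=> //; exists v.
Qed.

Let index_set := (refuted * (A -> nat))%type.
Let factor (i : index_set) : algebra := sval (cid (refutation_exists i.1)).
Let factorK i : K (factor i).
Proof. by rewrite /factor; case: cid => B []. Qed.
Let assignment_exists i :
  exists v : nat -> factor i, eval v (sval i.1).1 <> eval v (sval i.1).2.
Proof. by rewrite /factor; case: cid => B []. Qed.
Let assignment i := sval (cid (assignment_exists i)).
Let assignmentP i :
  eval (assignment i) (sval i.1).1 <> eval (assignment i) (sval i.1).2.
Proof. by rewrite /assignment; case: cid. Qed.

Let P := product factor.
Let gen (a : A) : P := fun i => assignment i (i.2 a).

Let generated (p : P) := exists t (g : nat -> A), p = eval (gen \o g) t.

(** Even variables carry [g1] and odd ones [g2], so that terms under unrelated assignments can be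
    compared under a single one. *)
Let merge (g1 g2 : nat -> A) n := if odd n then g2 n./2 else g1 n./2.
Let mergel g1 g2 : merge g1 g2 \o double =1 g1.
Proof. by move=> n; rewrite /merge /= odd_double doubleK. Qed.
Let merger g1 g2 : merge g1 g2 \o (fun n => n.*2.+1) =1 g2.
Proof. by move=> n; rewrite /merge /= odd_double /= uphalf_double. Qed.

Let eval_mergel (B : algebra) (h : A -> B) g1 g2 t :
  eval (h \o g1) t = eval (h \o merge g1 g2) (rename double t).
Proof.
by rewrite eval_rename; apply: eq_eval => n /=; rewrite -[g1 n](mergel g1 g2).
Qed.
Let eval_merger (B : algebra) (h : A -> B) g1 g2 t :
  eval (h \o g2) t = eval (h \o merge g1 g2) (rename (fun n => n.*2.+1) t).
Proof.
by rewrite eval_rename; apply: eq_eval => n /=; rewrite -[g2 n](merger g1 g2).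
Qed.

Let generated_op (op : forall B : algebra, B -> B -> B) c p q :
  (forall (B : algebra) (v : nat -> B) t1 t2,
     eval v (c t1 t2) = op B (eval v t1) (eval v t2)) ->
  generated p -> generated q -> generated (op P p q).
Proof.
move=> cP [t1 [g1 ->]] [t2 [g2 ->]].
exists (c (rename double t1) (rename (fun n => n.*2.+1) t2)), (merge g1 g2).
by rewrite cP -eval_mergel -eval_merger.
Qed.

(** If the values differed in [A], the identity obtained by naming variables after the elements they
    denote would fail in [A], hence in [K]; the coordinate indexed by that identity then separates
    the two sides in the product. *)
Let generated_well_defined t1 t2 g1 g2 :
  eval (gen \o g1) t1 = eval (gen \o g2) t2 -> eval g1 t1 = eval g2 t2.
Proof.
rewrite (eval_mergel gen g1 g2) (eval_merger gen g1 g2).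
have -> : eval g1 t1 = eval (merge g1 g2) _ := eval_mergel id g1 g2 t1.
have -> : eval g2 t2 = eval (merge g1 g2) _ := eval_merger id g1 g2 t2.
move: (merge g1 g2) (rename _ t1) (rename _ t2) => g s1 s2 {t1 t2 g1 g2} s12.
(* [h] chooses one variable for each value of [g]; the default 0 is taken only off the range of
   [g]. *)
pose h (a : A) := if pselect (exists n, g n = a) is left ex then sval (cid ex) else 0.
have gh n : g (h (g n)) = g n.
  rewrite /h; case: pselect => [ex|]; first by case: cid.
  by case; exists n.
have gE s : eval g s = eval g (rename (h \o g) s).
  by rewrite eval_rename; apply: eq_eval => n /=; rewrite gh.
apply: contrapT => ne.
have eP : ~ identities K (rename (h \o g) s1, rename (h \o g) s2).
  by move=> /AK /(_ g) /=; rewrite -!gE.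
pose i : index_set := (exist (fun e => ~ identities K e) _ eP, h).
apply: (assignmentP (i := i)); rewrite /= !eval_rename.
by have := congr1 (fun p : P => p i) s12; rewrite /P !eval_product.
Qed.

Lemma quotient_of_subproduct : K A.
Proof.
have [homK subK prodK] := Kvar.
pose C := {p : P | generated p}.
have Cinh : inhabited C.
  case: (carrier_inhabited A) => a; split.
  by exists (gen a), (Var 0), (fun=> a).
have genD p q : generated p -> generated q -> generated (add p q).
  exact: (@generated_op (fun B => @add B) Add).
have genM p q : generated p -> generated q -> generated (mul p q).
  exact: (@generated_op (fun B => @mul B) Mul).
pose B := @Algebra C Cinh
  (fun p q => exist _ _ (genD _ _ (svalP p) (svalP q)))
  (fun p q => exist _ _ (genM _ _ (svalP p) (svalP q))).
have KB : K B.
  apply: (subK P B (fun p : B => sval p)) => //; last exact: prodK factorK.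
  by move=> [p pP] [q qP] /= pq; apply: eq_exist.
(* The quotient map [val] chooses a word for [p] and evaluates it in [A]; by
   [generated_well_defined] the choice is immaterial. *)
pose word (p : B) := cid (svalP p).
pose val (p : B) := eval (sval (cid (svalP (word p)))) (sval (word p)).
have valP (p : B) t g : sval p = eval (gen \o g) t -> val p = eval g t.
  by move=> pE; apply: generated_well_defined; rewrite -pE; case: cid.
apply: (homK B A val) KB; last first.
  move=> a; have ga : generated (gen a) by exists (Var 0), (fun=> a).
  by exists (exist _ _ ga); apply: (valP _ (Var 0) (fun=> a)).
split=> [[p [t1 [g1 pE]]] [q [t2 [g2 qE]]]|[p [t1 [g1 pE]]] [q [t2 [g2 qE]]]].
- rewrite [X in _ = add X _](valP _ t1 g1)// [X in _ = add _ X](valP _ t2 g2)//.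
  rewrite (valP _ (Add (rename double t1) (rename (fun n => n.*2.+1) t2))
    (merge g1 g2)) /=.
    by rewrite -(eval_mergel id) -(eval_merger id).
  by rewrite -eval_mergel -eval_merger pE qE.
- rewrite [X in _ = mul X _](valP _ t1 g1)// [X in _ = mul _ X](valP _ t2 g2)//.
  rewrite (valP _ (Mul (rename double t1) (rename (fun n => n.*2.+1) t2))
    (merge g1 g2)) /=.
    by rewrite -(eval_mergel id) -(eval_merger id).
  by rewrite -eval_mergel -eval_merger pE qE.
Qed.

End Birkhoff.

Theorem Birkhoff (K : set algebra) : is_variety K -> K = models (identities K).
Proof.
move=> Kvar; apply/seteqP; split=> A; first by move=> KA e; apply.
exact: quotient_of_subproduct.
Qed.

Lemma generated_varietyE (S : algebra) :
  generated_variety S = models (identities [set S]).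
Proof.
apply/seteqP; split=> [A|A AS K [Kvar KS]].
  by apply; split; [exact: models_variety|move=> _ -> e; apply].
by rewrite (Birkhoff Kvar) => e eK; apply: AS => B ->; apply: eK; apply: KS.
Qed.

(** * Rules between monomials *)

(* [Zm] stands for all the monomials of degree at least 3, whose value is the
   greatest element of the algebras considered here. *)
Inductive mono := Lm of nat | Qm of nat & nat | Zm.

Definition mulm (m1 m2 : mono) : mono :=
  if (m1, m2) is (Lm i, Lm j) then Qm i j else Zm.

Fixpoint mons (t : term) : set mono :=
  match t with
  | Var n => [set Lm n]
  | Add s t => mons s `|` mons t
  | Mul s t => [set m | exists m1 m2, [/\ mons s m1, mons t m2 & m = mulm m1 m2]]
  end.

Definition term_of (m : mono) : term :=
  match m with
  | Lm n => Var n
  | Qm n k => Mul (Var n) (Var k)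
  | Zm => Mul (Var 0) (Mul (Var 0) (Var 0))
  end.

Fixpoint sum_term (m : mono) (s : seq mono) : term :=
  if s is m' :: s' then Add (term_of m) (sum_term m' s') else term_of m.

(* The empty sum is read as [Zm]. *)
Definition ineq (s : seq mono) (m : mono) : identity :=
  let t := sum_term (head Zm s) (behead s) in (t, Add t (term_of m)).

Lemma mons_neq0 t : exists m, mons t m.
Proof.
elim: t => [n|t1 [m1 h1] t2 _|t1 [m1 h1] t2 [m2 h2]] /=; first by exists (Lm n).
  by exists m1; left.
by exists (mulm m1 m2), m1, m2.
Qed.

(** * Rules over a graph with marked vertices *)

Section Entailment.
Variables (X : Type) (e : X -> X -> Prop) (l : X -> Prop).

Definition sat (v : nat -> X) (m : mono) : Prop :=
  match m with
  | Lm n => l (v n)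
  | Qm n k => e (v n) (v k)
  | Zm => forall x, l x
  end.

Definition entails (T : set mono) (m : mono) : Prop :=
  forall v, (forall m', T m' -> sat v m') -> sat v m.

Definition sat_all (v : nat -> X) (s : seq mono) : Prop :=
  foldr (fun m P => sat v m /\ P) True s.

Definition entails_seq (s : seq mono) (m : mono) : Prop :=
  forall v, sat_all v s -> sat v m.

(** The common properties of the graphs {xy <= u}. The vertex [c] in [edge_isolated] is the product
    of [x] and [y] itself: an edge at it bounds a product of three factors by [u], so [u] is the
    greatest element. *)
Record graph_with_marks : Prop := GraphWithMarks {
  edge_sym : forall x y, e x y -> e y x;
  edge_top : (forall x, l x) -> forall x y, e x y;
  edge_loop : forall x, e x x -> forall x, l x;
  edge_isolated : forall x y, e x y ->
    exists2 c, l c & forall w, e c w -> forall x, l x }.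

End Entailment.

Definition le (A : algebra) (x y : A) := add x y = y.
Definition edge (A : algebra) (u x y : A) := le (mul x y) u.
Definition below (A : algebra) (u x : A) := le x u.

(** The last two laws make products of three factors and squares the greatest element. Associativity
    of the multiplication follows, both bracketings being greatest. *)
Record base (A : algebra) : Prop := Base {
  addA : forall x y z : A, add x (add y z) = add (add x y) z;
  addC : forall x y : A, add x y = add y x;
  addxx : forall x : A, add x x = x;
  mulC : forall x y : A, mul x y = mul y x;
  mulDr : forall x y z : A, mul x (add y z) = add (mul x y) (mul x z);
  mul3 : forall x y z w : A, add w (mul x (mul y z)) = mul x (mul y z);
  mulxx : forall x w : A, add w (mul x x) = mul x x }.

Section Base.
Variables (A : algebra) (bA : base A).
Implicit Types (x y z u : A) (v : nat -> A).

Lemma lexx x : le x x. Proof. exact: addxx. Qed.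

Lemma le_trans y x z : le x y -> le y z -> le x z.
Proof. by rewrite /le => xy <-; rewrite (addA bA) xy. Qed.

Lemma le_anti x y : le x y -> le y x -> x = y.
Proof. by rewrite /le => xy; rewrite (addC bA) xy. Qed.

Lemma add_le x y u : le (add x y) u <-> le x u /\ le y u.
Proof.
have lel (a b : A) : le a (add a b) by rewrite /le (addA bA) (addxx bA).
split=> [xyu|[xu yu]].
  by split; apply: le_trans xyu => //; rewrite (addC bA).
by rewrite /le -(addA bA) yu.
Qed.

Lemma eq_le x y : (forall u, le x u <-> le y u) -> x = y.
Proof. by move=> xy; apply: le_anti; apply/xy; exact: lexx. Qed.

Lemma mul3_le x y z u : le (mul x (mul y z)) u <-> forall w, le w u.
Proof. by split=> [h w|]; [apply: le_trans h; exact: mul3|apply]. Qed.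

Lemma mulxx_le x u : le (mul x x) u <-> forall w, le w u.
Proof. by split=> [h w|]; [apply: le_trans h; exact: mulxx|apply]. Qed.

Lemma edge_graph u : graph_with_marks (edge u) (below u).
Proof.
split=> [x y|h x y|x|x y xy].
- by rewrite /edge (mulC bA).
- exact: h.
- by move/mulxx_le.
- by exists (mul x y) => // w; rewrite /edge (mulC bA) => /mul3_le.
Qed.

Definition mono_val v m := eval v (term_of m).

Lemma mono_val_le v m u : le (mono_val v m) u <-> sat (edge u) (below u) v m.
Proof. by case: m => //=; exact: mul3_le. Qed.

Lemma mulm_val v m1 m2 u :
  le (mul (mono_val v m1) (mono_val v m2)) u <-> le (mono_val v (mulm m1 m2)) u.
Proof.
by case: m1 => [i|i j|]; case: m2 => [k|k k'|] //=;
  rewrite /mono_val /= ?mul3_le // (mulC bA) mul3_le.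
Qed.

(** Sums are handled by distributivity. If [t] is a product, all monomials times [y] have degree at
    least three and both sides say that [u] is greatest; the converse needs that [t] has some
    monomial. *)
Lemma eval_mul_le v t y u :
  le (mul (eval v t) y) u <-> forall m, mons t m -> le (mul (mono_val v m) y) u.
Proof.
elim: t y => [n|s IHs t IHt|s _ t _] y /=.
- by split=> [h m ->|/(_ (Lm n) erefl)].
- rewrite (mulC bA) (mulDr bA) add_le !(mulC bA y) IHs IHt.
  by split=> [[hs ht] m [|]|h]; [exact: hs|exact: ht|split=> m hm; apply: h; [left|right]].
- rewrite (mulC bA) mul3_le; split=> [h m _|]; first exact: h.
  have [m1 h1] := mons_neq0 s; have [m2 h2] := mons_neq0 t.
  move=> /(_ (mulm m1 m2)) h.
  have {h}: le (mul (mono_val v (mulm m1 m2)) y) u by apply: h; exists m1, m2.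
  by rewrite (mulC bA); case: m1 {h1} => [i|i j|]; case: m2 {h2} => [k|k k'|] /mul3_le.
Qed.

Lemma eval_le v t u :
  le (eval v t) u <-> forall m, mons t m -> sat (edge u) (below u) v m.
Proof.
transitivity (forall m, mons t m -> le (mono_val v m) u); last first.
  by split=> h m /h /mono_val_le.
elim: t => [n|s IHs t IHt|s _ t _] /=.
- by split=> [h m ->|/(_ (Lm n) erefl)].
- rewrite add_le IHs IHt.
  by split=> [[hs ht] m [|]|h]; [exact: hs|exact: ht|split=> m hm; apply: h; [left|right]].
- rewrite eval_mul_le; split=> [h m [m1 [m2 [h1 h2 ->]]]|h m1 h1].
    move/h: h1; rewrite (mulC bA) => /eval_mul_le /(_ _ h2).
    by rewrite (mulC bA) => /mulm_val.
  rewrite (mulC bA); apply/eval_mul_le => m2 h2; rewrite (mulC bA); apply/mulm_val.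
  by apply: h; exists m1, m2.
Qed.

(** An element is determined by its upper bounds [u], and bounding a term means bounding all its
    monomials. *)
Lemma satisfies_entails (t s : term) :
  satisfies A (t, s) <-> forall u,
    (forall m, mons s m -> entails (edge u) (below u) (mons t) m) /\
    (forall m, mons t m -> entails (edge u) (below u) (mons s) m).
Proof.
split=> [ts u|h v /=].
  by split=> m hm v /eval_le; [rewrite (ts v)|rewrite -(ts v)] => /eval_le; apply.
apply: eq_le => u; split=> /eval_le tu; apply/eval_le => m hm.
  by apply: (h u).1 tu.
by apply: (h u).2 tu.
Qed.

Lemma satisfies_ineq (s : seq mono) (m : mono) : s <> [::] ->
  satisfies A (ineq s m) <-> forall u, entails_seq (edge u) (below u) s m.
Proof.
case: s => // m0 s _; rewrite /ineq /=.
have sumE v u : le (eval v (sum_term m0 s)) u <-> sat_all (edge u) (below u) v (m0 :: s).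
  elim: s m0 => [|m1 s IH] m0 /=; first by rewrite -mono_val_le /mono_val; tauto.
  by rewrite add_le IH -mono_val_le.
split=> [h u v /sumE|h v /=].
  by rewrite (h v) /= => /add_le[_ /mono_val_le].
apply: eq_le => u; rewrite add_le; split=> [h'|[]//]; split=> //.
by apply/mono_val_le/h/sumE.
Qed.

End Base.

(** * Reduction of the rules to ten laws *)

Section Laws.
Variables (X : Type) (e : X -> X -> Prop) (l : X -> Prop).

(** For symmetric [e]: vertices joined by a walk of odd length are adjacent. *)
Definition square_closed : Prop :=
  forall x1 y2 x2 y1, e x1 y2 -> e x2 y2 -> e x2 y1 -> e x1 y1.

(* Modulo [square_closed], every rule is equivalent to a conjunction of these. *)
Definition law (k : nat) : Prop :=
  match k with
  | 0 => forall x y, l x -> l y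
  | 1 => forall x y, e x y -> l x
  | 2 => forall x y x', e x y -> e x' y -> l x -> l x'
  | 3 => forall x y, e x y -> l y -> l x
  | 4 => forall x y x', e x y -> e x' y -> l x -> l y -> l x'
  | 5 => forall x y u v, e x y -> l x -> e u v -> l u -> e x v
  | 6 => forall x y u v, e x y -> e u v -> l u -> l v -> l x
  | 7 => forall x y x' u v,
           e x y -> e x' y -> l x -> e u v -> l u -> l v -> l x'
  | 8 => forall x y u v, e x y -> l y -> e u v -> l u -> l v -> l x
  | 9 => forall x y, e x y -> l x -> l y -> forall w, l w
  | _ => True
  end.

Definition laws (s : seq nat) : Prop := foldr (fun k P => law k /\ P) True s.

End Laws.

Definition square_rule : seq mono * mono := ([:: Qm 0 1; Qm 2 1; Qm 2 3], Qm 0 3).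

Definition law_rule (k : nat) : seq mono * mono :=
  nth ([:: Zm], Zm)
    [:: ([:: Lm 0], Lm 1);
        ([:: Qm 0 1], Lm 0);
        ([:: Qm 0 1; Qm 2 1; Lm 0], Lm 2);
        ([:: Qm 0 1; Lm 1], Lm 0);
        ([:: Qm 0 1; Qm 2 1; Lm 0; Lm 1], Lm 2);
        ([:: Qm 0 1; Lm 0; Qm 2 3; Lm 2], Qm 0 3);
        ([:: Qm 0 1; Qm 2 3; Lm 2; Lm 3], Lm 0);
        ([:: Qm 0 1; Qm 2 1; Lm 0; Qm 3 4; Lm 3; Lm 4], Lm 2);
        ([:: Qm 0 1; Lm 1; Qm 2 3; Lm 2; Lm 3], Lm 0);
        ([:: Qm 0 1; Lm 0; Lm 1], Zm)] k.

Definition assign (X : Type) (x y z u w : X) (n : nat) : X :=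
  match n with 0 => x | 1 => y | 2 => z | 3 => u | _ => w end.

Section Rules.
Variables (X : Type) (e : X -> X -> Prop) (l : X -> Prop).

Lemma square_ruleP :
  entails_seq e l square_rule.1 square_rule.2 <-> square_closed e.
Proof.
split=> [h x y z w xy zy zw|h v /= [a [b [c _]]]]; last exact: h a b c.
by apply: (h (assign x y z w x)).
Qed.

Lemma law_ruleP k : entails_seq e l (law_rule k).1 (law_rule k).2 <-> law e l k.
Proof.
do 10? [case: k => [|k]];
  last by split=> // _ v; rewrite /law_rule nth_default //= => -[].
all: split=> [h|h v /=]; last by intuition eauto.
- by move=> x y lx; have := h (assign x y x x x); rewrite /=; tauto.
- by move=> x y xy; have := h (assign x y x x x); rewrite /=; tauto.
- by move=> x y x' xy x'y lx; have := h (assign x y x' x x); rewrite /=; tauto.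
- by move=> x y xy ly; have := h (assign x y x x x); rewrite /=; tauto.
- by move=> x y x' xy x'y lx ly; have := h (assign x y x' x x); rewrite /=; tauto.
- by move=> x y u v xy lx uv lu; have := h (assign x y u v x); rewrite /=; tauto.
- by move=> x y u v xy uv lu lv; have := h (assign x y u v x); rewrite /=; tauto.
- by move=> x y x' u v xy x'y lx uv lu lv; have := h (assign x y x' u v); rewrite /=; tauto.
- by move=> x y u v xy ly uv lu lv; have := h (assign x y u v x); rewrite /=; tauto.
- by move=> x y xy lx ly; have := h (assign x y x x x); rewrite /=; tauto.
Qed.

End Rules.

(** * Walks, colorings and marked vertices in the graph of [T] *)

Section Walks.
Variable (T : set mono).

Definition adj (x y : nat) : Prop := T (Qm x y) \/ T (Qm y x).

(** The Boolean is the parity of the length, [true] for odd walks. *)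
Inductive walk : bool -> nat -> nat -> Prop :=
  | walk0 x : walk false x x
  | walkS b x y z of walk b x y & adj y z : walk (~~ b) x z.

Definition connected (x y : nat) : Prop := exists b, walk b x y.

Lemma adjC x y : adj x y -> adj y x.
Proof. by case; [right|left]. Qed.

Lemma walk1 x y : adj x y -> walk true x y.
Proof. exact: (walkS (walk0 x)). Qed.

Lemma walk_trans b c x y z : walk b x y -> walk c y z -> walk (b (+) c) x z.
Proof.
move=> xy yz; elim: yz xy => [y'|c' y' w z' _ IH wz] xy; first by rewrite addbF.
by rewrite addbN; apply: walkS wz; exact: IH.
Qed.

Lemma walk_sym b x y : walk b x y -> walk b y x.
Proof.
elim=> {b x y} [x|b x y z _ yx /adjC/walk1 zy]; first exact: walk0.
by have := walk_trans zy yx; rewrite addTb.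
Qed.

Lemma connected_sym x y : connected x y -> connected y x.
Proof. by case=> b /walk_sym; exists b. Qed.

Lemma connected_trans y x z : connected x y -> connected y z -> connected x z.
Proof. by case=> b xy [c yz]; exists (b (+) c); exact: walk_trans yz. Qed.

Lemma connected1 x y : adj x y -> connected x y.
Proof. by move/walk1; exists true. Qed.

Section Sat.
Variables (X : Type) (e : X -> X -> Prop) (l : X -> Prop) (v : nat -> X).
Hypotheses (g : graph_with_marks e l) (sq : square_closed e).
Hypothesis (Tv : forall m, T m -> sat e l v m).

Lemma sat_adj x y : adj x y -> e (v x) (v y).
Proof. by case=> /Tv //=; exact: (edge_sym g). Qed.

(** The square axiom collapses an odd walk to an edge and an even one to an inclusion of
    neighbourhoods, a form that extends by one step. *)
Lemma sat_walk b x y : walk b x y ->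
  if b then e (v x) (v y) else forall w, e (v y) w -> e (v x) w.
Proof.
elim=> {b x y} [//|b x y z _ IH /sat_adj yz].
case: b IH => IH /=; last exact: IH.
by move=> w zw; apply: sq IH _ zw; exact: (edge_sym g).
Qed.

End Sat.

Definition coloring (c : nat -> bool) : Prop := forall x y, adj x y -> c y = ~~ c x.

Lemma coloring_walk c b x y : coloring c -> walk b x y -> c y = c x (+) b.
Proof.
move=> cc; elim=> {b x y} [x|b x y z _ IH /cc ->]; first by rewrite addbF.
by rewrite IH addbN.
Qed.

Lemma coloring_flip c (p : nat -> Prop) :
  coloring c -> (forall x y, connected x y -> p x -> p y) ->
  coloring (fun w => c w (+) `[< p w >]).
Proof.
move=> cc pP x y xy; rewrite (cc _ _ xy) addNb; congr (~~ (_ (+) _)).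
by apply: asbool_equiv_eq; split; apply: pP; [apply: connected_sym|]; exact: connected1.
Qed.

Hypothesis bipartite : forall x, ~ walk true x x.

Lemma coloring_exists : exists c, coloring c.
Proof.
(* [rep x] depends only on the component of [x], being chosen in a set common to all its vertices;
   the color is the parity of a walk from it. *)
pose rep x := xget 0 [set r | connected r x].
have repP x : connected (rep x) x.
  by rewrite /rep; case: xgetP => [r _ //|/(_ x)[]]; exists false; exact: walk0.
exists (fun x => `[< walk true (rep x) x >]) => x y xy.
have -> : rep y = rep x.
  rewrite /rep; congr (xget _ _); apply/seteqP; split=> r /=.
    by move=> ry; apply: connected_trans ry (connected_sym (connected1 xy)).
  by move=> rx; apply: connected_trans rx (connected1 xy).
rewrite -asbool_neg; apply: asbool_equiv_eq; case: (repP x) => b rx.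
split=> [ry rx'|nrx].
  by apply: (bipartite (x := rep x)); have := walk_trans ry (walk_sym (walkS rx' xy)).
by case: b rx => // rx; exact: walkS rx xy.
Qed.

Lemma coloring_eq x y : ~ walk true x y -> exists2 c, coloring c & c x = c y.
Proof.
move=> nxy; have [c cc] := coloring_exists.
case: (eqVneq (c x) (c y)) => [|cxy]; first by exists c.
have nconn : ~ connected x y.
  case=> -[//|xy]; move: cxy; rewrite (coloring_walk cc xy) addbF eqxx //.
exists (fun w => c w (+) `[< connected y w >]).
  by apply: coloring_flip => // a b ab ya; exact: connected_trans ab.
have -> : `[< connected y y >] = true by apply/asboolP; exists false; exact: walk0.
rewrite (asboolF (P := connected y x)); last by move/connected_sym.
by move: cxy; case: (c x); case: (c y).
Qed.

Definition vertex x := exists y, adj x y.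
Definition marked x := T (Lm x).

(* Some component has a marked vertex on either side. *)
Definition both_marked := exists x y, [/\ marked x, marked y & walk true x y].

Definition marked_true (c : nat -> bool) := forall x, marked x -> c x.

Lemma walk_vertex b x y : walk b x y -> b -> vertex y.
Proof. by case=> // {}b {}x {}y z _ yz _; exists y; exact: adjC. Qed.

Hypothesis one_sided : ~ both_marked.

(** Colors are exchanged on the components having a marked vertex of color [false]; no component
    being marked on both sides, all its marked vertices turn [true]. *)
Lemma coloring_marked : exists2 c, coloring c & marked_true c.
Proof.
have [c cc] := coloring_exists.
pose p w := exists x, [/\ marked x, connected x w & c x = false].
exists (fun w => c w (+) `[< p w >]).
  apply: coloring_flip => // x y xy [z [mz zx cz]]; exists z; split=> //.
  exact: connected_trans xy.
move=> x mx; case: asboolP => [[z [mz [b zx] cz]]|np].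
  rewrite (coloring_walk cc zx) cz; case: b zx => // zx.
  by case: one_sided; exists z, x.
case cx : (c x) => //; case: np; exists x; split=> //.
by exists false; exact: walk0.
Qed.

(** If the colors differ, the component of [x] or of [y] can be flipped as long as it has no marks.
    When both have marks, these all have color [true], so they lie on opposite sides relative to [x]
    and [y]. *)
Lemma coloring_marked_eq x y : ~ walk true x y ->
  (exists c, [/\ coloring c, marked_true c & c x = c y]) \/
  (exists x0 y0, [/\ marked x0, marked y0 &
    walk false x0 x /\ walk true y0 y \/ walk true x0 x /\ walk false y0 y]) .
Proof.
move=> nxy; have [c cc cm] := coloring_marked.
case: (eqVneq (c x) (c y)) => [|cxy]; first by left; exists c.
have nconn : ~ connected x y.
  by case=> -[//|xy]; move: cxy; rewrite (coloring_walk cc xy) addbF eqxx.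
have flip z : z = x \/ z = y -> ~ (exists2 w, marked w & connected w z) ->
    exists c, [/\ coloring c, marked_true c & c x = c y].
  move=> zxy nm; exists (fun w => c w (+) `[< connected z w >]); split.
  - by apply: coloring_flip => // a b ab za; exact: connected_trans ab.
  - move=> w mw; rewrite (cm _ mw) asboolF// => zw; apply: nm.
    by exists w => //; exact: connected_sym.
  - have zz w : connected w w by exists false; exact: walk0.
    case: zxy => -> {z nm}; rewrite (asboolT (zz _)) asboolF//.
    + by move: cxy; case: (c x); case: (c y).
    + by move: cxy; case: (c x); case: (c y).
    + by move/connected_sym.
have [[x0 mx [b xx]]|/flip h] := pselect (exists2 w, marked w & connected w x); last first.
  by left; apply: h; left.
have [[y0 my [d yy]]|/flip h] := pselect (exists2 w, marked w & connected w y); last first.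
  by left; apply: h; right.
right; exists x0, y0; split=> //; move: cxy.
rewrite (coloring_walk cc xx) (coloring_walk cc yy) !cm//.
by case: b xx => xx; case: d yy => yy // _; [right|left].
Qed.

End Walks.

Lemma top_sat (X : Type) (e : X -> X -> Prop) (l : X -> Prop) v m :
  graph_with_marks e l -> (forall x, l x) -> sat e l v m.
Proof. by move=> g h; case: m => //= i j; apply: (edge_top g). Qed.

(** * Rules with a bipartite premise, folded onto one or two edges *)

Section Decomposition.
Variable (T : set mono).
Hypotheses (noZ : ~ T Zm) (bipartite : forall x, ~ walk T true x x).

Definition equivalent_to (m : mono) (s : seq nat) : Prop :=
  forall X (e : X -> X -> Prop) (l : X -> Prop),
    graph_with_marks e l -> square_closed e -> entails e l T m <-> laws e l s.

Section Assignments.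
Variables (X : Type) (e : X -> X -> Prop) (l : X -> Prop).
Hypothesis g : graph_with_marks e l.
Variable c : nat -> bool.
Hypothesis cc : coloring T c.

Definition two_valued (p q : X) (d : nat -> X) (w : nat) : X :=
  if `[< vertex T w >] then if c w then p else q else d w.

Lemma two_valued_sat p q d m : e p q ->
  (forall w, marked T w -> vertex T w -> l (if c w then p else q)) ->
  (forall w, marked T w -> ~ vertex T w -> l (d w)) ->
  T m -> sat e l (two_valued p q d) m.
Proof.
move=> pq lpq ld; rewrite /two_valued; case: m => [w|i j|//] Tm /=.
  by case: asboolP => vw; [exact: lpq|exact: ld].
have ij : adj T i j by left.
rewrite !asboolT; [|by exists i; apply: adjC|by exists j].
by rewrite (cc ij); case: (c i) => //=; exact: (edge_sym g).
Qed.

(* The component of [z] goes to [x] (marked vertices on the side of [z]), [x']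
   (the other vertices on that side) and [y]; the other components go to [p]
   and [q]. *)
Definition folding (z : nat) (x x' y p q c0 : X) (w : nat) : X :=
  if `[< vertex T w >] then
    if `[< connected T z w >] then
      if c w == c z then if `[< marked T w >] then x else x' else y
    else if c w then p else q
  else c0.

Lemma folding_sat z x x' y p q c0 m :
  l c0 -> e x y -> e x' y -> e p q ->
  (forall w, marked T w -> walk T false z w -> l x) ->
  (forall w, marked T w -> walk T true z w -> l y) ->
  (forall w, marked T w -> vertex T w -> l (if c w then p else q)) ->
  T m -> sat e l (folding z x x' y p q c0) m.
Proof.
move=> lc xy x'y pq lx ly lpq; rewrite /folding; case: m => [w|i j|//] Tm /=.
  case: asboolP => vw //; case: asboolP => [[b zw]|]; last by move=> _; exact: lpq.
  rewrite (coloring_walk cc zw); case: b zw => zw.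
    by rewrite addbT; case: (c z) => /=; exact: ly zw.
  by rewrite addbF eqxx asboolT//; exact: lx zw.
have ij : adj T i j by left.
have zij : `[< connected T z i >] = `[< connected T z j >].
  apply: asbool_equiv_eq; split=> h; apply: connected_trans h _.
    exact: connected1.
  by apply: connected1; exact: adjC.
rewrite zij !(asboolT (P := vertex T _)); [|by exists i; apply: adjC|by exists j].
rewrite (cc ij); case: ifP => _.
  case: (c i); case: (c z) => /=; case: ifP => _ //; exact: (edge_sym g).
by case: (c i) => //=; exact: (edge_sym g).
Qed.

End Assignments.

(** The laws by which [T] forces the greatest element. Modulo the square axiom this only depends on
    whether a component is marked on both sides, a vertex on an edge is marked, or neither. *)
Definition zero_laws : seq nat :=
  if `[< both_marked T >] then [:: 9]
  else if `[< exists2 x, marked T x & vertex T x >] then [:: 3; 9]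
  else [:: 1; 9].

Definition admissible (c : nat -> bool) : Prop :=
  coloring T c /\ (~ both_marked T -> marked_true T c).

Hypothesis has_edge : exists x y, adj T x y.

(* [m] is refuted, unless the greatest element is reached, by all assignments
   which map the graph of [T] onto a single edge according to [c]. *)
Lemma equivalent_to_zero m c : admissible c ->
  (forall X (e : X -> X -> Prop) (l : X -> Prop), graph_with_marks e l ->
     forall p q, e p q ->
     (forall w, marked T w -> vertex T w -> l (if c w then p else q)) ->
     entails e l T m -> forall x, l x) ->
  equivalent_to m zero_laws.
Proof.
move=> [cc cm] Hm X e l g sq; rewrite /zero_laws.
have [a [b ab]] := has_edge.
case: asboolP => [[x [y [mx my xy]]]|P2].
  split=> [Tm|[h9 _] v Tv]; last first.
    by apply: (top_sat _ _ g); apply: (h9 (v x) (v y)) => //;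
      [exact: (sat_walk g sq Tv xy)|exact: Tv mx|exact: Tv my].
  by split=> // p q pq lp lq; apply: (Hm _ _ _ g _ _ pq _ Tm) => w _ _; case: (c w).
have {}cm := cm P2.
case: asboolP => [[x mx [y xy]]|P1].
  split=> [Tm|[h3 [h9 _]] v Tv]; last first.
    have exy := sat_adj g Tv xy; have lx := Tv _ mx.
    by apply: (top_sat _ _ g); apply: (h9 _ _ exy) => //; apply: (h3 _ (v x));
      first exact: (edge_sym g).
  split=> [p q pq lq|].
    by apply: (Hm _ _ _ g _ _ (edge_sym g pq) _ Tm) => w mw _; rewrite cm.
  by split=> // p q pq lp lq; apply: (Hm _ _ _ g _ _ pq _ Tm) => w _ _; case: (c w).
have {}P1 w : marked T w -> vertex T w -> False by move=> mw vw; apply: P1; exists w.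
split=> [Tm|[h1 [h9 _]] v Tv]; last first.
  have eab := sat_adj g Tv ab.
  by apply: (top_sat _ _ g); apply: (h9 _ _ eab);
    [exact: h1 eab|exact: h1 (edge_sym g eab)].
split=> [p q pq|].
  by apply: (Hm _ _ _ g _ _ pq _ Tm) => w mw /(P1 _ mw).
by split=> // p q pq lp lq; apply: (Hm _ _ _ g _ _ pq _ Tm) => w _ _; case: (c w).
Qed.

Lemma admissible_exists : exists c, admissible c.
Proof.
have [P2|P2] := pselect (both_marked T).
  by have [c cc] := coloring_exists bipartite; exists c; split.
by have [c cc cm] := coloring_marked bipartite P2; exists c; split.
Qed.

Lemma equivalent_to_Zm : equivalent_to Zm zero_laws.
Proof.
have [c ac] := admissible_exists; apply: (equivalent_to_zero ac) => X e l g p q pq lpq.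
have [c0 lc0 _] := edge_isolated g pq.
move=> Tz; apply: (Tz (two_valued c p q (fun=> c0))) => m.
exact: (two_valued_sat g ac.1 pq lpq).
Qed.

Lemma equivalent_to_isolated z :
  ~ T (Lm z) -> ~ vertex T z -> equivalent_to (Lm z) zero_laws.
Proof.
move=> nT nv; have [c ac] := admissible_exists.
apply: (equivalent_to_zero ac) => X e l g p q pq lpq Tz x.
have [c0 lc0 _] := edge_isolated g pq.
have := Tz (two_valued c p q (fun w => if w == z then x else c0)).
rewrite /= /two_valued (asboolF nv) eqxx; apply => m.
apply: (two_valued_sat g ac.1 pq lpq) => w mw _.
by case: eqP => // wz; rewrite wz in mw.
Qed.

(** The isolated factor is sent to [c0], any edge at which forces the greatest element. *)
Lemma equivalent_to_isolated_product x y :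
  ~ vertex T x \/ ~ vertex T y -> equivalent_to (Qm x y) zero_laws.
Proof.
move=> nv; have [c ac] := admissible_exists.
apply: (equivalent_to_zero ac) => X e l g p q pq lpq Tz w.
have [c0 lc0 ec0] := edge_isolated g pq.
have {Tz} := Tz (two_valued c p q (fun=> c0)).
have val z : ~ vertex T z -> two_valued c p q (fun=> c0) z = c0.
  by move=> nvz; rewrite /two_valued asboolF.
have h m : T m -> sat e l (two_valued c p q (fun=> c0)) m.
  exact: (two_valued_sat g ac.1 pq lpq).
move=> /(_ h) /= exy; case: nv => /val E; rewrite E in exy; first exact: ec0 exy _.
exact: ec0 (edge_sym g exy) _.
Qed.

(** Folding along [c] turns the product of [x] and [y] into a loop. *)
Lemma equivalent_to_same_color x y c : admissible c -> c x = c y ->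
  vertex T x -> vertex T y -> equivalent_to (Qm x y) zero_laws.
Proof.
move=> ac cxy vx vy.
apply: (equivalent_to_zero ac) => X e l g p q pq lpq Tz w.
have [c0 lc0 _] := edge_isolated g pq.
have h m : T m -> sat e l (two_valued c p q (fun=> c0)) m.
  exact: (two_valued_sat g ac.1 pq lpq).
have := Tz _ h; rewrite /= /two_valued !asboolT// cxy => exy.
exact: (edge_loop g exy).
Qed.

(** [x] and [y] lie in different components, marked on the side of [x] and on the side opposite to
    [y]. Folding these onto two edges yields law 5; conversely law 5 joins [x0] to [y], and the
    square axiom moves this edge to [x]. *)
Lemma equivalent_to_merge x y x0 y0 :
  ~ both_marked T -> ~ walk T true x y -> vertex T x -> vertex T y ->
  marked T x0 -> marked T y0 -> walk T false x0 x -> walk T true y0 y ->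
  equivalent_to (Qm x y) [:: 5].
Proof.
move=> P2 nxy [x1 xx1] vy mx my xx yy X e l g sq; split=> [Txy|[h5 _] v Tv]; last first.
  have ex0 := sat_walk g sq Tv (walkS xx xx1).
  have ey0 := sat_walk g sq Tv yy.
  have /= := h5 _ _ _ _ ex0 (Tv _ mx) ey0 (Tv _ my).
  by apply: sq; [exact: sat_adj Tv _ _ xx1|exact: ex0].
split=> // p q u v pq lp uv lu.
have [c cc cm] := coloring_marked bipartite P2.
have [c0 lc0 _] := edge_isolated g pq.
have := Txy (folding c x p p q u v c0); rewrite /= /folding.
have vx : vertex T x by exists x1.
have cxx : connected T x x by exists false; exact: walk0.
rewrite (asboolT vx) (asboolT vy) (asboolT cxx) eqxx.
rewrite (asboolF (P := connected T x y)); last first.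
  case=> b xy; case: b xy => // xy; apply: P2; exists x0, y0; split=> //.
  by have := walk_trans (walk_trans xx xy) (walk_sym yy).
rewrite (coloring_walk cc yy) (cm _ my) if_same; apply=> m.
apply: (folding_sat g cc) => //.
- move=> w mw xw; case: P2; exists x0, w; split=> //.
  by have := walk_trans xx xw.
- by move=> w mw; rewrite cm.
Qed.

Definition same_side_marked z := exists2 w, marked T w & walk T false z w.
Definition other_side_marked z := exists2 w, marked T w & walk T true z w.

Definition linear_laws (z : nat) : seq nat :=
  if `[< same_side_marked z >] then
    if `[< other_side_marked z >] then [:: 4]
    else if `[< both_marked T >] then [:: 7] else [:: 2]
  else if `[< other_side_marked z >] then
    if `[< both_marked T >] then [:: 8] else [:: 3]
  else if `[< both_marked T >] then [:: 6]
  else if `[< exists2 x, marked T x & vertex T x >] then [:: 3; 6] else [:: 1].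

Lemma equivalent_to_linear z :
  ~ T (Lm z) -> vertex T z -> equivalent_to (Lm z) (linear_laws z).
Proof.
move=> nT vz X e l g sq; have [c [cc cm]] := admissible_exists.
(* [z] is unmarked and hence lands on [x']. Each law below arises from a choice of [x], [x'], [y]
   and of the edge [p q] receiving the other components. *)
have fold x x' y p q : entails e l T (Lm z) -> e x y -> e x' y -> e p q ->
    (same_side_marked z -> l x) -> (other_side_marked z -> l y) ->
    (both_marked T -> l q) ->
    ((exists2 x, marked T x & vertex T x) -> l p) -> l x'.
  move=> Tz xy x'y pq lx ly l2 l1; have [c0 lc0 _] := edge_isolated g xy.
  have := Tz (folding c z x x' y p q c0).
  have czz : connected T z z by exists false; exact: walk0.
  rewrite /= /folding (asboolT vz) (asboolT czz) eqxx asboolF//; apply=> m.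
  apply: (folding_sat g cc) => //.
  - by move=> w mw zw; apply: lx; exists w.
  - by move=> w mw zw; apply: ly; exists w.
  - move=> w mw vw; case cw : (c w); first by apply: l1; exists w.
    by apply: l2; apply: contrapT => /cm /(_ w mw); rewrite cw.
have both_vertex : both_marked T -> exists2 x, marked T x & vertex T x.
  by case=> x [y [mx my /walk_vertex xy]]; exists y => //; exact: xy.
have [z1 zz1] := vz; rewrite /linear_laws.
case: asboolP => [sz|nsz]; case: asboolP => [oz|noz].
- split=> [Tz|[h4 _] v Tv].
    by split=> // x y x' xy x'y lx ly; apply: (fold x x' y x y).
  case: sz oz => [a ma za] [b mb zb].
  apply: (h4 (v a) (v b)); [|exact: (sat_walk g sq Tv zb)|exact: Tv ma|exact: Tv mb].
  by have /= := sat_walk g sq Tv (walk_trans (walk_sym za) zb).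
- case: asboolP => [P2|P2]; split.
  + by move=> Tz; split=> // x y x' u v xy x'y lx uv lu lv; apply: (fold x x' y u v).
  + move=> [h7 _] v Tv; case: P2 sz => [a [b [ma mb ab]]] [w mw zw].
    apply: (h7 (v w) (v z1) _ (v a) (v b));
      [|exact: (sat_adj g Tv zz1)|exact: Tv mw| |exact: Tv ma|exact: Tv mb].
      exact: (sat_walk g sq Tv (walkS (walk_sym zw) zz1)).
    exact: (sat_walk g sq Tv ab).
  + by move=> Tz; split=> // x y x' xy x'y lx; apply: (fold x x' y x y).
  + move=> [h2 _] v Tv; case: sz => [w mw zw].
    apply: (h2 (v w) (v z1)); [|exact: (sat_adj g Tv zz1)|exact: Tv mw].
    exact: (sat_walk g sq Tv (walkS (walk_sym zw) zz1)).
- case: asboolP => [P2|P2]; split.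
  + by move=> Tz; split=> // x y u v xy ly uv lu lv; apply: (fold x x y u v).
  + move=> [h8 _] v Tv; case: P2 oz => [a [b [ma mb ab]]] [w mw zw].
    apply: (h8 _ (v w) (v a) (v b)); [|exact: Tv mw| |exact: Tv ma|exact: Tv mb].
      exact: (sat_walk g sq Tv zw).
    exact: (sat_walk g sq Tv ab).
  + by move=> Tz; split=> // x y xy ly; apply: (fold x x y y x) => //; exact: (edge_sym g).
  + move=> [h3 _] v Tv; case: oz => [w mw zw].
    by apply: (h3 _ (v w)); [exact: (sat_walk g sq Tv zw)|exact: Tv mw].
- case: asboolP => [P2|P2]; last case: asboolP => [P1|P1]; split.
  + by move=> Tz; split=> // x y u v xy uv lu lv; apply: (fold x x y u v).
  + move=> [h6 _] v Tv; case: P2 => [a [b [ma mb ab]]].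
    apply: (h6 _ (v z1) (v a) (v b));
      [exact: (sat_adj g Tv zz1)| |exact: Tv ma|exact: Tv mb].
    exact: (sat_walk g sq Tv ab).
  + move=> Tz; split=> [x y xy ly|].
      by apply: (fold x x y y x) => //; exact: (edge_sym g).
    by split=> // x y u v xy uv lu lv; apply: (fold x x y u v).
  + move=> [h3 [h6 _]] v Tv; case: P1 => [a ma [b ab]].
    have eab := sat_adj g Tv ab; have la := Tv _ ma.
    apply: (h6 _ (v z1) _ _ (sat_adj g Tv zz1) eab) => //.
    by apply: (h3 _ (v a)) => //; exact: (edge_sym g).
  + by move=> Tz; split=> // x y xy; apply: (fold x x y x y).
  + by move=> [h1 _] v Tv; apply: (h1 _ (v z1)); exact: (sat_adj g Tv zz1).
Qed.

End Decomposition.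

Lemma decomposition (T : set mono) (m : mono) : (exists m', T m') ->
  exists s : seq nat, all (fun k => k < 10) s /\
  forall X (e : X -> X -> Prop) (l : X -> Prop),
    graph_with_marks e l -> square_closed e -> entails e l T m <-> laws e l s.
Proof.
move=> [m0 Tm0].
have [|] := pselect [\/ T Zm, T m, (exists x, walk T true x x) |
    exists2 p, m = Qm p.1 p.2 & walk T true p.1 p.2].
  move=> h; exists [::]; split=> // X e l g sq; split=> // _ v Tv.
  case: h => [/Tv /= h|/Tv//|[x /(sat_walk g sq Tv) h]|[[x y] -> /(sat_walk g sq Tv)//]].
    exact: top_sat.
  by apply: top_sat => //; exact: (edge_loop g h).
move=> h; have nZ : ~ T Zm by move=> ?; apply: h; constructor 1.
have nm : ~ T m by move=> ?; apply: h; constructor 2.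
have bip x : ~ walk T true x x by move=> ?; apply: h; constructor 3; exists x.
have nw x y : m = Qm x y -> ~ walk T true x y.
  by move=> mE xy; apply: h; constructor 4; exists (x, y).
move=> {h}; have [has_edge|no_edge] := pselect (exists x y, adj T x y); last first.
  have lin m' : T m' -> exists x, m' = Lm x.
    case: m' => [x||//]; first by exists x.
    by move=> x y Txy; case: no_edge; exists x, y; left.
  exists [:: 0]; split=> // X e l g sq; split=> [Tm|[h0 _] v Tv]; last first.
    have [x xE] := lin _ Tm0; rewrite xE in Tm0.
    by apply: top_sat => // y; apply: (h0 (v x)); exact: Tv Tm0.
  split=> // x y lx.
  (* Under [const] a product becomes a loop; under [split_by] a variable absent from [T] takes the
     value [y]. *)
  have const m' : T m' -> sat e l (fun=> x) m' by move/lin => [w ->].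
  have split_by m' : T m' -> sat e l (fun w => if `[< T (Lm w) >] then x else y) m'.
    by move=> Tm'; have [w wE] := lin _ Tm'; rewrite wE in Tm' *; rewrite /= asboolT.
  case: m nm {nw} Tm => [z|a b|] nm Tm.
  - by have := Tm _ split_by; rewrite /= asboolF.
  - by have /(edge_loop g) := Tm _ const; apply.
  - exact: (Tm _ const).
have zero_lt : all (fun k => k < 10) (zero_laws T).
  by rewrite /zero_laws; case: asboolP => // _; case: asboolP.
case: m nm nw => [z|x y|] nm nw; last 1 first.
- by exists (zero_laws T); split=> //; exact: equivalent_to_Zm.
- have [vz|nvz] := pselect (vertex T z); last first.
    by exists (zero_laws T); split=> //; exact: equivalent_to_isolated.
  exists (linear_laws T z); split; last exact: equivalent_to_linear.
  by rewrite /linear_laws; do ![case: asboolP => // _].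
have {}nw := nw _ _ erefl.
have [vx|nvx] := pselect (vertex T x); last first.
  by exists (zero_laws T); split=> //; apply: equivalent_to_isolated_product => //; left.
have [vy|nvy] := pselect (vertex T y); last first.
  by exists (zero_laws T); split=> //; apply: equivalent_to_isolated_product => //; right.
have same_color c : admissible T c -> c x = c y ->
    exists s : seq nat, all (fun k => k < 10) s /\ equivalent_to T (Qm x y) s.
  move=> ac cxy; exists (zero_laws T); split=> //.
  exact: equivalent_to_same_color ac cxy vx vy.
have [P2|P2] := pselect (both_marked T).
  by have [c cc cxy] := coloring_eq bip nw; apply: (same_color c).
have [[c [cc cm cxy]]|] := coloring_marked_eq bip P2 nw; first exact: (same_color c).
case=> [x0 [y0 [mx my [[xx yy]|[xx yy]]]]]; exists [:: 5]; split=> //.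
  exact: equivalent_to_merge mx my xx yy.
have nw' : ~ walk T true y x by move/walk_sym.
have eq := equivalent_to_merge nZ bip P2 nw' vy vx my mx yy xx.
move=> X e l g sq; rewrite -(eq _ _ _ g sq); clear -g.
by split=> H v /H; exact: (edge_sym g).
Qed.

(** * Profiles of subvarieties *)

Definition axiom (k : nat) : identity :=
  let x := Var 0 in let y := Var 1 in let z := Var 2 in let w := Var 3 in
  nth (x, x)
    [:: (Add x (Add y z), Add (Add x y) z);
        (Add x y, Add y x);
        (Add x x, x);
        (Mul x y, Mul y x);
        (Mul x (Add y z), Add (Mul x y) (Mul x z));
        (Add w (Mul x (Mul y z)), Mul x (Mul y z));
        (Add w (Mul x x), Mul x x);
        ineq square_rule.1 square_rule.2] k.

Definition test (k : nat) : identity := ineq (law_rule k).1 (law_rule k).2.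

Definition square_axioms : set identity := axiom @` `I_8.

Lemma base_axiomP A : base A <-> forall k, k < 7 -> satisfies A (axiom k).
Proof.
split=> [[aA aC axx mC mD m3 mxx]|h].
  by do 7? [case=> [_ v|]; first by rewrite /=; eauto].
have ev k (kP : k < 7) x y z w := h k kP (assign x y z w w).
split=> [x y z|x y|x|x y|x y z|x y z w|x w].
- exact: (ev 0 isT x y z x).
- exact: (ev 1 isT x y x x).
- exact: (ev 2 isT x x x x).
- exact: (ev 3 isT x y x x).
- exact: (ev 4 isT x y z x).
- exact: (ev 5 isT x y z w).
- exact: (ev 6 isT x x x w).
Qed.

Lemma square_axiomsP A :
  models square_axioms A <-> base A /\ forall u : A, square_closed (edge u).
Proof.
split=> [h|[bA sq] _ [k k8 <-]].
  have bA : base A by apply/base_axiomP => k k7; apply: h; exists k => //;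
    exact: leq_trans k7 _.
  split=> // u; apply/(square_ruleP _ (@below A u)).
  by apply: (iffLR (satisfies_ineq bA _ _)) => //; apply: h; exists 7.
have := k8; rewrite /= ltnS leq_eqVlt => /orP[/eqP ->|k7]; last exact: (base_axiomP A).1.
by apply/(satisfies_ineq bA) => // u; apply/square_ruleP.
Qed.

Lemma law_rule_neq0 k : (law_rule k).1 <> [::].
Proof. by do 10? [case: k => [|k]] => //=; rewrite /law_rule nth_default. Qed.

Lemma test_law A k : base A ->
  satisfies A (test k) <-> forall u : A, law (edge u) (below u) k.
Proof.
move=> bA; have ne := @law_rule_neq0 k.
by split=> [/(satisfies_ineq bA _ ne) h u|h];
  [apply/law_ruleP|apply/(satisfies_ineq bA _ ne) => u; apply/law_ruleP].
Qed.

Lemma lawsP X (e : X -> X -> Prop) l s :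
  laws e l s <-> forall k, k \in s -> law e l k.
Proof.
elim: s => [|k s IH] /=; first by split.
rewrite IH; split=> [[hk hs] j|h]; first by rewrite in_cons => /predU1P[->//|]; exact: hs.
by split=> [|j js]; apply: h; rewrite in_cons ?eqxx// js orbT.
Qed.

(** [D] collects the laws of all rules in both directions of the identity, and is independent of the
    algebra. *)
Lemma identity_decomposition (i : identity) : exists D : set nat,
  D `<=` `I_10 /\ forall A, models square_axioms A ->
    satisfies A i <-> forall k, D k -> satisfies A (test k).
Proof.
case: i => t s; pose f t m := sval (cid (decomposition m (mons_neq0 t))).
have f10 t' m : all (fun k => k < 10) (f t' m) by rewrite /f; case: cid => ? [].
have fP t' m X (e : X -> X -> Prop) (l : X -> Prop) :
    graph_with_marks e l -> square_closed e ->
    entails e l (mons t') m <-> forall k, k \in f t' m -> law e l k.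
  move=> g sq; rewrite -lawsP.
  exact: (svalP (cid (decomposition m (mons_neq0 t')))).2 X e l g sq.
exists [set k | (exists2 m, mons s m & k \in f t m) \/
                (exists2 m, mons t m & k \in f s m)].
split=> [k [|] [m _ kf]|A /square_axiomsP [bA sq]];
  [exact: (allP (f10 _ _) _ kf)|exact: (allP (f10 _ _) _ kf)|].
rewrite (satisfies_entails bA); split=> [h k D|h u].
  apply/(test_law _ bA) => u; have g := edge_graph bA u.
  case: D => -[m mm kf]; first exact: ((fP _ _ _ _ _ g (sq u)).1 ((h u).1 m mm)).
  exact: ((fP _ _ _ _ _ g (sq u)).1 ((h u).2 m mm)).
have g := edge_graph bA u.
split=> m mm; apply/(fP _ _ _ _ _ g (sq u)) => k kf.
  by move: u {g}; apply/(test_law _ bA)/h; left; exists m.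
by move: u {g}; apply/(test_law _ bA)/h; right; exists m.
Qed.

Lemma subvariety_axioms (W : set algebra) :
  is_variety W -> W `<=` models square_axioms ->
  W = models (square_axioms `|` test @` [set k | k < 10 /\ identities W (test k)]).
Proof.
move=> Wvar WU; apply/seteqP; split=> A WA.
  by move=> i [/(WU _ WA)//|[k [_ kW] <-]]; exact: kW.
rewrite (Birkhoff Wvar) => i iW; have [D [D10 DP]] := identity_decomposition i.
apply/DP => [j hj|k Dk]; first by apply: WA; left.
apply: WA; right; exists k => //; split; first exact: D10.
by move=> B WB; apply: (DP B (WU _ WB)).1 Dk; exact: iW.
Qed.

Lemma finite_tests (P : set nat) :
  finite_set (square_axioms `|` test @` [set k | k < 10 /\ P k]).
Proof.
rewrite finite_setU; split; apply: finite_image; first exact: finite_II.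
by apply: sub_finite_set (finite_II 10) => k [].
Qed.

Lemma subvariety_finitely_based (W : set algebra) :
  is_variety W -> W `<=` models square_axioms -> finitely_based W.
Proof.
move=> Wvar WU; eexists; last exact: (subvariety_axioms Wvar WU).
exact: finite_tests.
Qed.

Definition profile (W : set algebra) : bitseq :=
  mkseq (fun k => `[< identities W (test k) >]) 10.

Lemma profileP W k : k < 10 -> nth false (profile W) k <-> identities W (test k).
Proof.
by move=> k10; rewrite /profile nth_mkseq//; split=> [/asboolP|h]//; exact/asboolP.
Qed.

Lemma size_profile W : size (profile W) = 10.
Proof. exact: size_mkseq. Qed.

Lemma profile_inj W W' : is_variety W -> is_variety W' ->
  W `<=` models square_axioms -> W' `<=` models square_axioms ->
  profile W = profile W' -> W = W'.
Proof.
move=> Wv W'v WU W'U WW'; rewrite (subvariety_axioms Wv WU) (subvariety_axioms W'v W'U).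
congr (models (_ `|` test @` _)); apply/seteqP; split=> k [k10 kW].
  by split=> //; apply/profileP => //; rewrite -WW'; apply/profileP.
by split=> //; apply/profileP => //; rewrite WW'; apply/profileP.
Qed.

(** The content of [law_implications] in computable form. The bit vectors closed under it turn out
    to be exactly the profiles. *)
Definition implications (b : nat -> bool) : bool :=
  all (fun ij => all b ij.1 ==> b ij.2)
    [:: ([:: 0], 1); ([:: 0], 9); ([:: 1], 3); ([:: 1], 6); ([:: 3], 2);
        ([:: 3], 8); ([:: 2], 7); ([:: 6], 8); ([:: 8], 7); ([:: 7], 4);
        ([:: 9], 6); ([:: 5], 9); ([:: 3; 9], 5)].

Section Implications.
Variables (X : Type) (e : X -> X -> Prop) (l : X -> Prop).
Hypothesis g : graph_with_marks e l.
Local Notation L := (law e l).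
Let es := edge_sym g.

Lemma law_implications :
  [/\ L 0 -> L 1, L 0 -> L 9, L 1 -> L 3, L 1 -> L 6 & L 3 -> L 2] /\
  [/\ L 3 -> L 8, L 2 -> L 7, L 6 -> L 8, L 8 -> L 7 & L 7 -> L 4] /\
  [/\ L 9 -> L 6, L 5 -> L 9 & L 3 -> L 9 -> L 5].
Proof.
split; last split; split; rewrite /=.
- by move=> h x y xy; have [c lc _] := edge_isolated g xy; exact: h lc.
- by move=> h x y _ lx _ w; exact: h lx.
- by move=> h x y xy _; exact: h xy.
- by move=> h x y u v xy *; exact: h xy.
- by move=> h x y x' xy x'y lx; apply: (h _ _ x'y); exact: (h _ _ (es xy) lx).
- by move=> h x y u v xy ly *; exact: h xy ly.
- by move=> h x y x' u v xy x'y lx *; exact: h xy x'y lx.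
- by move=> h x y u v xy _; exact: h xy.
- move=> h x y x' u v xy x'y lx uv lu lv; apply: (h _ _ _ _ x'y _ uv) => //.
  exact: (h _ _ _ _ (es xy) lx uv).
- by move=> h x y x' xy x'y lx ly; exact: (h _ _ _ _ _ xy x'y lx xy).
- by move=> h x y u v xy uv lu lv; exact: (h _ _ uv).
- by move=> h x y xy lx ly; apply: (edge_loop g (h _ _ _ _ xy lx (es xy) ly)).
- move=> h3 h9 x y u v xy lx uv lu; apply: (edge_top g).
  by apply: (h9 _ _ xy) => //; exact: h3 (es xy) lx.
Qed.

End Implications.

Lemma profile_implications W :
  W `<=` models square_axioms -> implications (nth false (profile W)).
Proof.
move=> WU; have imp (s : seq nat) k : all (fun j => j < 10) s -> k < 10 ->
    (forall A, base A ->
       (forall j, j \in s -> satisfies A (test j)) -> satisfies A (test k)) ->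
    all (nth false (profile W)) s ==> nth false (profile W) k.
  move=> s10 k10 h; apply/implyP => /allP sW; apply/profileP => // A WA.
  have /square_axiomsP[bA _] := WU _ WA; apply: h => // j js.
  by have /profileP := sW _ js; apply=> //; exact: (allP s10).
have imp1 j k : j < 10 -> k < 10 ->
    (forall X (e : X -> X -> Prop) l, graph_with_marks e l -> law e l j -> law e l k) ->
    all (nth false (profile W)) [:: j] ==> nth false (profile W) k.
  move=> j10 k10 h; apply: imp => //=; first by rewrite j10.
  move=> A bA /(_ _ (mem_head _ _)) /(test_law _ bA) hj; apply/(test_law _ bA) => u.
  by apply: h (hj u); exact: edge_graph.
do ![apply/andP; split=> //]; cbn [fst snd].
all: try by apply: imp1 => // X e l g;
  have [[? ? ? ? ?] [[? ? ? ? ?] [? ? ?]]] := law_implications g; auto.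
apply: imp => // A bA h; apply/(test_law _ bA) => u.
have [_ [_ [_ _]]] := law_implications (edge_graph bA u); apply.
  by apply: (iffLR (test_law _ bA)); exact: h.
by apply: (iffLR (test_law _ bA)); exact: h.
Qed.

(** * Graph algebras *)

Fixpoint seq_set (s : seq mono) : set mono :=
  if s is m :: s' then m |` seq_set s' else set0.

Lemma entails_seqE X (e : X -> X -> Prop) l s m :
  entails_seq e l s m <-> entails e l (seq_set s) m.
Proof.
have E v : sat_all e l v s <-> forall m', seq_set s m' -> sat e l v m'.
  elim: s => [|m0 s IH] /=; first by split.
  rewrite IH; split=> [[h0 hs] m' [->//|]|h]; first exact: hs.
  by split=> [|m' sm']; apply: h; [left|right].
by split=> h v /E; exact: h.
Qed.

(* A family of maps that jointly embed one structure into a power of another. *)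
Record lifting (X X' : Type) (e : X -> X -> Prop) (l : X -> Prop)
    (e' : X' -> X' -> Prop) (l' : X' -> Prop) (F : set (X -> X')) : Prop := Lifting {
  lift_edge : forall f x y, F f -> e x y -> e' (f x) (f y);
  lift_mark : forall f x, F f -> l x -> l' (f x);
  reflect_edge : forall x y, (forall f, F f -> e' (f x) (f y)) -> e x y;
  reflect_mark : forall x, (forall f, F f -> l' (f x)) -> l x;
  lift_nonempty : exists f, F f;
  source_no_top : ~ (forall x, l x);
  target_no_top : ~ (forall x, l' x) }.

Section Lifting.
Variables (X X' : Type) (e : X -> X -> Prop) (l : X -> Prop).
Variables (e' : X' -> X' -> Prop) (l' : X' -> Prop) (F : set (X -> X')).
Hypothesis L : lifting e l e' l' F.

Lemma lifting_sat f v m : F f -> sat e l v m -> sat e' l' (f \o v) m.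
Proof.
by move=> Ff; case: m => //= *;
  [exact: (lift_mark L)|exact: (lift_edge L)|case: (source_no_top L)].
Qed.

Lemma lifting_reflect v m : (forall f, F f -> sat e' l' (f \o v) m) -> sat e l v m.
Proof.
case: m => [a|a b|] /= h; [exact: (reflect_mark L)|exact: (reflect_edge L)|].
by have [f /h] := lift_nonempty L; case/(target_no_top L).
Qed.

Lemma lifting_entails T m : entails e' l' T m -> entails e l T m.
Proof.
move=> Tm v Tv; apply: lifting_reflect => f Ff; apply: Tm => m' /Tv.
exact: lifting_sat.
Qed.

End Lifting.

Lemma lifting_law (X X' : Type) (e : X -> X -> Prop) l (e' : X' -> X' -> Prop) l' F k :
  lifting e l e' l' F -> law e' l' k -> law e l k.
Proof.
by move=> L; rewrite -!law_ruleP !entails_seqE; exact: (lifting_entails L).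
Qed.

Lemma lifting_square (X X' : Type) (e : X -> X -> Prop) l (e' : X' -> X' -> Prop) l' F :
  lifting e l e' l' F -> square_closed e' -> square_closed e.
Proof.
move=> L; rewrite -(square_ruleP e l) -(square_ruleP e' l') !entails_seqE.
exact: (lifting_entails L).
Qed.

(* Adds to [V] two isolated vertices: [Pc], marked, and [P0], unmarked. *)
Inductive pointed (V : Type) := P0 | Pc | Pv of V.
Arguments P0 {V}. Arguments Pc {V}.

Section GraphAlgebra.
Variables (V : Type) (e : V -> V -> Prop) (l : V -> Prop).
Hypotheses (eC : forall x y, e x y -> e y x) (eirr : forall x, ~ e x x).

Definition pedge (x y : pointed V) : Prop :=
  if (x, y) is (Pv a, Pv b) then e a b else False.

Definition pmark (x : pointed V) : Prop :=
  match x with P0 => False | Pc => True | Pv a => l a end.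

(* Not [set V], whose universe is too large for a carrier. *)
Definition nonempty := {A : V -> Prop | exists x, A x}.

Lemma nonempty_eq (A B : nonempty) : (forall x, sval A x <-> sval B x) -> A = B.
Proof.
case: A B => [A hA] [B hB] /= AB; apply: eq_exist.
by apply: functional_extensionality_dep => x; apply: propext.
Qed.

Lemma union_nonempty (A B : nonempty) : exists x, sval A x \/ sval B x.
Proof. by case: A => /= A [x Ax]; exists x; left. Qed.

Definition union (A B : nonempty) : nonempty :=
  exist _ (fun x => sval A x \/ sval B x) (union_nonempty A B).

(** [Gs A] is the formal sum of the vertices in [A], [Gc] the product of any two adjacent vertices,
    with the marked vertices below it, and [G0] the greatest element. *)
Inductive graph_elt := G0 | Gc | Gs of nonempty.

Definition all_marked (A : nonempty) : bool := `[< forall x, sval A x -> l x >].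
Definition complete (A B : nonempty) : bool :=
  `[< forall x y, sval A x -> sval B y -> e x y >].

Definition graph_add (x y : graph_elt) : graph_elt :=
  match x, y with
  | G0, _ | _, G0 => G0
  | Gc, Gc => Gc
  | Gc, Gs A | Gs A, Gc => if all_marked A then Gc else G0
  | Gs A, Gs B => Gs (union A B)
  end.

Definition graph_mul (x y : graph_elt) : graph_elt :=
  if (x, y) is (Gs A, Gs B) then if complete A B then Gc else G0 else G0.

Definition graph_algebra : algebra := Algebra (inhabits G0) graph_add graph_mul.

Lemma all_marked_union A B : all_marked (union A B) = all_marked A && all_marked B.
Proof.
rewrite /all_marked -asbool_and; apply: asbool_equiv_eq => /=.
split=> [h|[h1 h2] x [|]].
- by split=> x Ax; apply: h; [left|right].
- exact: h1.
- exact: h2.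
Qed.

Lemma complete_union A B C : complete A (union B C) = complete A B && complete A C.
Proof.
rewrite /complete -asbool_and; apply: asbool_equiv_eq => /=.
split=> [h|[h1 h2] x y Ax [|]].
- by split=> x y Ax By; apply: h => //; [left|right].
- exact: h1.
- exact: h2.
Qed.

Lemma complete_sym A B : complete A B = complete B A.
Proof. by apply: asbool_equiv_eq; split=> h x y Ax By; apply/eC/h. Qed.

Lemma completexx A : complete A A = false.
Proof.
by apply: asboolF; case: (svalP A) => x Ax /(_ _ _ Ax Ax); exact: eirr.
Qed.

Lemma graph_algebra_base : base graph_algebra.
Proof.
split.
- move=> [||A] [||B] [||C] //=; rewrite /graph_add ?all_marked_union.
  all: try by repeat match goal with
    |- context [all_marked ?D] => case: (all_marked D) end.
  by congr Gs; apply: nonempty_eq => x /=; tauto.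
- move=> [||A] [||B] //=; by congr Gs; apply: nonempty_eq => x /=; tauto.
- move=> [||A] //=; by congr Gs; apply: nonempty_eq => x /=; tauto.
- by move=> [||A] [||B] //=; rewrite /graph_mul complete_sym.
- move=> [||A] [||B] [||C] //=; rewrite /graph_mul /graph_add ?complete_union.
  all: try by repeat match goal with
    | |- context [all_marked ?D] => case: (all_marked D)
    | |- context [complete ?D ?F] => case: (complete D F)
    end.
- move=> [||A] [||B] [||C] [||D] //=; rewrite /graph_mul; try by case: (complete _ _).
- by move=> [||A] [||D] //=; rewrite /graph_mul ?completexx.
Qed.

Let E (u : graph_elt) := @edge graph_algebra u.
Let L (u : graph_elt) := @below graph_algebra u.

Lemma below_c x : L Gc x <-> x = Gc \/ exists2 A, x = Gs A & forall a, sval A a -> l a.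
Proof.
rewrite /L /below /le; case: x => [||A] /=; split=> //.
- by case=> [//|[]].
- by left.
- by case: ifPn => // /asboolP h _; right; exists A.
- by case=> [//|[B [<-] /asboolT h]]; rewrite /all_marked h.
Qed.

Lemma edge_c x y : E Gc x y <->
  exists A B, [/\ x = Gs A, y = Gs B & forall a b, sval A a -> sval B b -> e a b].
Proof.
rewrite /E /edge /le /= /graph_mul; split; last first.
  by case=> A [B [-> -> /asboolT h]]; rewrite /complete h.
case: x y => [||A] [||B] //=; case: ifP => // /asboolP h _.
by exists A, B.
Qed.

Lemma edge_s A x y : ~ E (Gs A) x y.
Proof.
rewrite /E /edge /le /= /graph_mul.
by case: x y => [||B] [||C] //=; case: (complete B C) => //=; case: (all_marked A).
Qed.

Lemma top_0 : forall x, L G0 x.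
Proof. by case. Qed.

(** Two sets are completely joined iff every choice of a vertex in each gives an edge; so the
    selections jointly embed the structure at [Gc] into a power of the pointed graph. *)
Definition selection (f : graph_elt -> pointed V) : Prop :=
  [/\ f G0 = P0, f Gc = Pc & forall A, exists2 a, sval A a & f (Gs A) = Pv a].

Lemma selection_exists : exists f, selection f.
Proof.
exists (fun x =>
  match x with G0 => P0 | Gc => Pc | Gs A => Pv (sval (cid (svalP A))) end).
by split=> // A; exists (sval (cid (svalP A))) => //; case: cid.
Qed.

Lemma selection_through A a : sval A a -> exists2 f, selection f & f (Gs A) = Pv a.
Proof.
move=> Aa; have [f [f0 fc fs]] := selection_exists.
exists (fun x => if `[< x = Gs A >] then Pv a else f x); last by rewrite asboolT.
split=> [||B]; try by rewrite asboolF.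
by case: asboolP => [[->]|_]; [exists a|exact: fs].
Qed.

Lemma graph_lifting :
  lifting (E Gc) (L Gc) pedge pmark selection.
Proof.
split.
- move=> f x y [f0 fc fs] /edge_c[A [B [-> -> AB]]].
  by case: (fs A) => a Aa ->; case: (fs B) => b Bb -> /=; exact: AB.
- move=> f x [f0 fc fs] /below_c [->|[A -> Al]]; first by rewrite fc.
  by case: (fs A) => a Aa -> /=; exact: Al.
- move=> x y h; apply/edge_c.
  have [f sf] := selection_exists; have := h f sf; case: (sf) => f0 fc fs.
  case: x h => [||A] h; rewrite ?f0 ?fc //; case: y h => [||B] h; rewrite ?f0 ?fc //.
    by case: (fs A) => a _ ->.
    by case: (fs A) => a _ ->.
  move=> _ {f sf f0 fc fs}; exists A, B; split=> // a b Aa Bb.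
  have [f sf fA] := selection_through Aa.
  (* A selection cannot choose [a] and [b] independently if [A = B], but then it already yields a
     loop. *)
  have [AB|AB] := pselect (A = B).
    by have := h f sf; rewrite -AB fA /= => /eirr.
  case: (sf) => f0 fc fs.
  have := h (fun x => if `[< x = Gs B >] then Pv b else f x).
  rewrite (asboolT (P := Gs B = Gs B))// asboolF; last by case.
  rewrite fA /=; apply; split=> [||C]; try by rewrite asboolF.
  by case: asboolP => [[->]|_]; [exists b|exact: fs].
- move=> x h; apply/below_c; case: x h => [||A] h.
  + by have [f sf] := selection_exists; have := h f sf; case: sf => ->.
  + by left.
  + right; exists A => // a /selection_through[f sf fA].
    by have := h f sf; rewrite fA.
- exact: selection_exists.
- by move/(_ G0)/below_c => -[//|[]].
- by move/(_ P0).
Qed.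

Definition singleton (a : V) : nonempty :=
  exist _ (fun x => x = a) (ex_intro _ a erefl).

Definition embed (x : pointed V) : graph_elt :=
  match x with P0 => G0 | Pc => Gc | Pv a => Gs (singleton a) end.

Lemma embed_lifting : lifting pedge pmark (E Gc) (L Gc) [set embed].
Proof.
split.
- move=> _ [||a] [||b] -> //= ab; apply/edge_c.
  by exists (singleton a), (singleton b); split=> // x y /= -> ->.
- move=> _ [||a] -> //= la; apply/below_c => /=; first [by left|right].
  by exists (singleton a) => // x /= ->.
- move=> x y /(_ _ erefl)/edge_c[A [B []]].
  by case: x y => [||a] [||b] //= [<-] [<-]; apply.
- move=> x /(_ _ erefl)/below_c[|[A]]; first by case: x.
  by case: x => //= a [<-]; apply.
- by exists embed.
- by move/(_ P0).
- by move/(_ G0)/below_c => -[//|[]].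
Qed.

Lemma graph_test k : satisfies graph_algebra (test k) <-> law pedge pmark k.
Proof.
rewrite (test_law k graph_algebra_base); split=> [h|h u].
  by apply: lifting_law embed_lifting (h Gc).
case: u => [||A].
- apply/law_ruleP => v _; apply: top_sat top_0.
  exact: (edge_graph graph_algebra_base G0).
- exact: lifting_law graph_lifting h.
(* There are no edges at [Gs A], and law 0 is the only law without an edge in its premises; it fails
   in the pointed graph, where [Pc] is marked and [P0] is not. *)
- have n x y : edge (A := graph_algebra) (Gs A) x y -> False by exact: edge_s.
  case: k h => [h|k _]; first by have := h Pc P0 I.
  by do 9? [case: k => [|k]] => //=; move=> > /n.
Qed.

Lemma graph_square : square_closed pedge -> models square_axioms graph_algebra.
Proof.
move=> sq; apply/square_axiomsP; split=> [|u]; first exact: graph_algebra_base.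
case: u => [||A].
- by move=> *; exact: top_0.
- exact: lifting_square graph_lifting sq.
- by move=> x y z w /edge_s.
Qed.

End GraphAlgebra.

(** * Counting the profiles *)

Fixpoint bitseqs (n : nat) : seq bitseq :=
  if n is n'.+1 then
    [seq true :: s | s <- bitseqs n'] ++ [seq false :: s | s <- bitseqs n']
  else [:: [::]].

Lemma mem_bitseqs n s : size s = n -> s \in bitseqs n.
Proof.
elim: n s => [|n IH] [|b s] //= [/IH sn]; rewrite mem_cat.
by case: b; rewrite map_f ?orbT.
Qed.

Definition closed_profiles : seq bitseq :=
  [seq s <- bitseqs 10 | implications (nth false s)].

Lemma profile_closed W : W `<=` models square_axioms -> profile W \in closed_profiles.
Proof.
by move=> /profile_implications h; rewrite mem_filter h mem_bitseqs// size_profile.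
Qed.

(** A path [va - vb - va'] and a separate edge [vc - vd]: the premise of law 7, the largest pattern
    among the laws. *)
Inductive five := va | va' | vb | vc | vd.

Definition five_edge (edges : bool) (x y : five) : bool :=
  match x, y with
  | va, vb | vb, va | va', vb | vb, va' | vc, vd | vd, vc => edges
  | _, _ => false
  end.

Definition five_mark (marks : bitseq) (x : five) : bool :=
  nth false marks
    match x with va => 0 | va' => 1 | vb => 2 | vc => 3 | vd => 4 end.

Definition model (edges : bool) (marks : bitseq) : algebra :=
  graph_algebra (five_edge edges) (five_mark marks).

Lemma five_edgeC edges x y : five_edge edges x y -> five_edge edges y x.
Proof. by case: x; case: y. Qed.

Lemma five_edge_irr edges x : ~ five_edge edges x x.
Proof. by case: x. Qed.

Lemma model_square edges marks : models square_axioms (model edges marks).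
Proof.
apply: graph_square => [x y|x|]; [exact: five_edgeC|exact: five_edge_irr|].
by case: edges => -[||[]] [||[]] //= [||[]] //= [||[]].
Qed.

Lemma model_test edges marks k : satisfies (model edges marks) (test k) <->
  law (pedge (five_edge edges)) (pmark (five_mark marks)) k.
Proof. by apply: graph_test => [x y|x]; [exact: five_edgeC|exact: five_edge_irr]. Qed.

(** A few laws determine the whole profile: by computation, [r] is the only closed profile that
    contains [pos] and avoids [neg]. *)
Lemma model_profile edges marks pos neg r :
  (forall k, k \in pos -> law (pedge (five_edge edges)) (pmark (five_mark marks)) k) ->
  ~ law (pedge (five_edge edges)) (pmark (five_mark marks)) neg ->
  all (fun k => k < 10) (neg :: pos) ->
  all (fun s => all (nth false s) pos && ~~ nth false s neg ==> (s == r))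
    closed_profiles ->
  profile [set model edges marks] = r.
Proof.
move=> hpos hneg /andP[neg10 /allP pos10] /allP closed.
have sub : [set model edges marks] `<=` models square_axioms.
  by move=> _ ->; exact: model_square.
apply/eqP; apply: (implyP (closed _ (profile_closed sub))); apply/andP; split.
  apply/allP => k kpos; apply/profileP; first exact: pos10.
  by move=> _ ->; apply/model_test/hpos.
apply/negP => /(profileP _ neg10)/(_ _ erefl)/model_test; exact: hneg.
Qed.

Definition profile_of (s : seq nat) : bitseq := mkseq (fun k => k \in s) 10.

(* The profiles that are not intersections of larger closed ones. *)
Definition model_table : seq (bitseq * (bool * bitseq)) :=
  [:: (profile_of [::], (true, [:: true; false; true; true; true]));
      (profile_of [:: 4], (true, [:: true; false; false; true; true]));
      (profile_of [:: 2; 4; 7], (true, [:: false; false; true; true; true]));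
      (profile_of [:: 2; 3; 4; 7; 8], (true, [:: false; false; false; true; true]));
      (profile_of [:: 1; 2; 3; 4; 6; 7; 8], (true, [:: true; true; true; true; true]));
      (profile_of [:: 2; 4; 6; 7; 8; 9], (true, [:: true; true; false; true; false]));
      (profile_of [:: 4; 5; 6; 7; 8; 9], (true, [:: true; false; false; false; false]));
      (profile_of [:: 2; 4; 5; 6; 7; 8; 9], (true, [:: true; true; false; false; false]));
      (profile_of [:: 2; 3; 4; 5; 6; 7; 8; 9], (true, [:: false; false; false; false; false]));
      (profile_of [:: 1; 2; 3; 4; 5; 6; 7; 8; 9], (false, [::]))].

Definition model_of (d : bool * bitseq) := model d.1 d.2.

Lemma model_tableP r d :
  (r, d) \in model_table -> profile [set model_of d] = r.
Proof.
rewrite !inE => /or4P[|||/or4P[|||/or4P[|||]]] /eqP[-> ->];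
  rewrite /model_of [_.1]/= [_.2]/=.
- apply: (@model_profile _ _ [::] 4) => [|h||];
    [|by have := h (Pv va) (Pv vb) (Pv va') isT isT isT isT|by []|by vm_compute].
  by [].
- apply: (@model_profile _ _ [:: 4] 7) => [|h||];
    [|by have := h (Pv va) (Pv vb) (Pv va') (Pv vc) (Pv vd) isT isT isT isT isT isT|by []|by vm_compute].
  by move=> k; rewrite !inE => /eqP -> /=; move=> [||[]] [||[]] //= [||[]] // [||[]].
- apply: (@model_profile _ _ [:: 2] 8) => [|h||];
    [|by have := h (Pv va) (Pv vb) (Pv vc) (Pv vd) isT isT isT isT isT|by []|by vm_compute].
  by move=> k; rewrite !inE => /eqP -> /=; move=> [||[]] [||[]] //= [||[]] // [||[]].
- apply: (@model_profile _ _ [:: 3] 6) => [|h||];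
    [|by have := h (Pv va) (Pv vb) (Pv vc) (Pv vd) isT isT isT isT|by []|by vm_compute].
  by move=> k; rewrite !inE => /eqP -> /=; move=> [||[]] [||[]] //= [||[]] // [||[]].
- apply: (@model_profile _ _ [:: 1] 9) => [|h||];
    [|by have := h (Pv va) (Pv vb) isT isT isT P0|by []|by vm_compute].
  by move=> k; rewrite !inE => /eqP -> /=; move=> [||[]] [||[]] //= [||[]] // [||[]].
- apply: (@model_profile _ _ [:: 2; 9] 5) => [|h||];
    [|by have := h (Pv va) (Pv vb) (Pv vc) (Pv vd) isT isT isT isT|by []|by vm_compute].
  by move=> k; rewrite !inE => /orP[] /eqP -> /=; move=> [||[]] [||[]] //= [||[]] // [||[]].
- apply: (@model_profile _ _ [:: 5] 2) => [|h||];
    [|by have := h (Pv va) (Pv vb) (Pv va') isT isT isT|by []|by vm_compute].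
  by move=> k; rewrite !inE => /eqP -> /=; move=> [||[]] [||[]] //= [||[]] // [||[]].
- apply: (@model_profile _ _ [:: 2; 5] 3) => [|h||];
    [|by have := h (Pv vb) (Pv va) isT isT|by []|by vm_compute].
  by move=> k; rewrite !inE => /orP[] /eqP -> /=; move=> [||[]] [||[]] //= [||[]] // [||[]].
- apply: (@model_profile _ _ [:: 3; 5] 1) => [|h||];
    [|by have := h (Pv va) (Pv vb) isT|by []|by vm_compute].
  by move=> k; rewrite !inE => /orP[] /eqP -> /=; move=> [||[]] [||[]] //= [||[]] // [||[]].
- apply: (@model_profile _ _ [:: 1; 9] 0) => [|h||];
    [|by have := h Pc P0 I|by []|by vm_compute].
  by move=> k; rewrite !inE => /orP[] /eqP -> /=; move=> [||[]] [||[]] //= [||[]] // [||[]].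
Qed.

Definition profile_le (r s : bitseq) :=
  all (fun k => nth false r k ==> nth false s k) (iota 0 10).

Lemma closed_profile_separated r k :
  r \in closed_profiles -> k < 10 -> ~~ nth false r k ->
  exists r' d, [/\ (r', d) \in model_table, profile_le r r' & ~~ nth false r' k].
Proof.
have /allP sep : all (fun r => all (fun k => nth false r k ||
    has (fun rd => profile_le r rd.1 && ~~ nth false rd.1 k) model_table)
  (iota 0 10)) closed_profiles by vm_compute.
move=> /sep/allP/(_ k); rewrite mem_iota => h k10 /negPf rk; have := h k10.
by rewrite rk => /hasP[[r' d] rd /andP[]]; exists r', d.
Qed.

Definition variety_of_profile (r : bitseq) : set algebra :=
  models (square_axioms `|` test @` [set k | k < 10 /\ nth false r k]).

Lemma variety_of_profile_sub r : variety_of_profile r `<=` models square_axioms.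
Proof. by move=> A h i si; apply: h; left. Qed.

(** A law outside [r] fails in some model of the table whose profile contains [r], and that model
    lies in the variety. *)
Lemma profile_variety_of r :
  r \in closed_profiles -> profile (variety_of_profile r) = r.
Proof.
move=> rc; have size_r : size r = 10.
  have /allP h : all (fun s => size s == 10) closed_profiles by vm_compute.
  by apply/eqP/h.
apply: (@eq_from_nth _ false) => [|k]; rewrite size_profile // => k10.
apply/idP/idP => [/(profileP _ k10) h|rk]; last first.
  by apply/profileP => // A; apply; right; exists k.
apply: contraT => /(closed_profile_separated rc k10)[r' [d [rd /allP rr' /negP]]]; case.
rewrite -(model_tableP rd); apply/profileP => // _ ->.
apply: h => i [|[j [j10 rj] <-]].
  exact: model_square.
have : nth false (profile [set model_of d]) j.
  rewrite (model_tableP rd); apply: (implyP (rr' j _)) rj.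
  by rewrite mem_iota.
by move=> /(profileP _ j10); apply.
Qed.

(** Profiles map these varieties bijectively onto the closed profiles containing [c], which are
    counted by their position in a list. *)
Lemma card_subvarieties (c : seq nat) : all (fun k => k < 10) c ->
  [set W | is_variety W /\
     W `<=` models (square_axioms `|` test @` [set k | k \in c])] #=
  `I_(size [seq s <- closed_profiles | all (nth false s) c]).
Proof.
move=> c10; set A := [set W | _]; set l := filter _ _.
have sub W : A W -> W `<=` models square_axioms.
  by move=> [_ h] B /h hB i si; apply: hB; left.
have inl W : A W -> profile W \in l.
  move=> AW; rewrite mem_filter profile_closed ?andbT; last exact: sub.
  apply/allP => k kc; apply/profileP; first exact: (allP c10).
  by move=> B WB; apply: (AW.2 _ WB); right; exists k.
have linj : {in A &, injective (fun W => index (profile W) l)}.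
  move=> W W' /set_mem AW /set_mem AW' /= WW'.
  apply: profile_inj AW.1 AW'.1 (sub _ AW) (sub _ AW') _.
  by rewrite -(nth_index [::] (inl _ AW)) WW' nth_index// inl.
have {linj} := inj_card_eq linj; rewrite card_eq_sym => /card_eq_trans; apply.
rewrite (_ : _ @` A = `I_(size l)) //; apply/seteqP; split=> [_ [W AW <-]|k kl] /=.
  by rewrite index_mem; exact: inl.
have lk : nth [::] l k \in l by exact: mem_nth.
have := lk; rewrite mem_filter => /andP[/allP ck kc].
exists (variety_of_profile (nth [::] l k)).
  split=> [|B hB i [si|[j jc <-]]]; first exact: models_variety.
    exact: (variety_of_profile_sub hB si).
  apply: hB; right; exists j => //; split; first exact: (allP c10).
  exact: ck.
rewrite profile_variety_of// index_uniq//.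
by apply: filter_uniq; vm_compute.
Qed.

(** * The algebras [R i j] *)

Lemma edgeless_lifting (X X' : Type) (e : X -> X -> Prop) l
    (e' : X' -> X' -> Prop) l' a b :
  (forall x y, ~ e x y) -> ~ (forall x, l x) ->
  (forall z, ~ e' a z) -> (forall z, ~ e' b z) -> l' a -> ~ l' b ->
  lifting e l e' l' [set fun x => if `[< l x >] then a else b].
Proof.
move=> ne nl ea eb la lb; split=> //.
- by move=> f x y _ /ne.
- by move=> f x -> lx; rewrite asboolT.
- by move=> x y /(_ _ erefl); case: asboolP => _ => [/ea|/eb].
- by move=> x /(_ _ erefl); case: asboolP.
- by eexists.
Qed.

Section ConcreteStructure.
Variables i j : nat.

Lemma M_le_refl x : M_le i j x x. Proof. exact: connect0. Qed.

Lemma M_le0 x : M_le i j x m0.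
Proof. by rewrite M_leE eqxx orbT. Qed.

Lemma M_eq_le x y : (forall z, M_le i j x z = M_le i j y z) -> x = y.
Proof.
by move=> h; apply: (@M_le_anti i j); rewrite h M_le_refl -h M_le_refl.
Qed.

Lemma R_le (x y : R i j) : le x y <-> M_le i j x y.
Proof.
rewrite /le /=; split=> [<-|xy]; last first.
  apply: M_eq_le => z; rewrite M_joinP; apply/andP/idP => [[]//|yz]; split=> //.
  exact: connect_trans xy yz.
by have := M_le_refl (M_join i j x y); rewrite M_joinP => /andP[].
Qed.

(* [M_mul x y] is [mc] iff [y] is below the partner of [x]. *)
Definition partner (x : M) : option M :=
  match x with
  | ma => Some mq | mb => Some mp | mp => Some mb | mq => Some ma | _ => None
  end.

Lemma M_mulE x y : M_mul x y =
  if partner x is Some n then if M_le i j y n then mc else m0 else m0.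
Proof. by case: x => //=; rewrite M_leE; case: y. Qed.

Lemma M_mulC x y : M_mul x y = M_mul y x.
Proof. by case: x; case: y. Qed.

Lemma R_base : base (R i j).
Proof.
split=> /=.
- by move=> x y z; apply: M_eq_le => w; rewrite !M_joinP andbA.
- by move=> x y; apply: M_eq_le => w; rewrite !M_joinP andbC.
- by move=> x; apply: M_eq_le => w; rewrite !M_joinP andbb.
- exact: M_mulC.
- move=> x y z; apply: M_eq_le => w; rewrite M_joinP !M_mulE.
  case: partner => [n|]; last by rewrite andbb.
  rewrite M_joinP; have c0 : M_le i j m0 w -> M_le i j mc w.
    by apply: connect_trans; exact: M_le0.
  case: (M_le i j y n); case: (M_le i j z n); rewrite /= ?andbb //.
    by apply/idP/andP => [h|[]//]; split=> //; exact: c0.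
  by apply/idP/andP => [h|[]//]; split=> //; exact: c0.
- move=> x y z w; have -> : M_mul x (M_mul y z) = m0 by case: x; case: y; case: z.
  by apply/R_le/M_le0.
- move=> x w; have -> : M_mul x x = m0 by case: x.
  by apply/R_le/M_le0.
Qed.

Definition cedge (x y : M) : bool := M_mul x y == mc.
Definition cmark (x : M) : bool := (x == mc) || M_gen i j x mc.

Lemma below_mc (x : R i j) : below (A := R i j) mc x <-> cmark x.
Proof. by rewrite /below R_le M_leE. Qed.

Lemma edge_mc (x y : R i j) : edge (A := R i j) mc x y <-> cedge x y.
Proof.
by rewrite /edge R_le M_leE /cedge; case: x; case: y.
Qed.

Lemma edge_other u : u <> mc -> u <> m0 -> forall x y, ~ edge (A := R i j) u x y.
Proof.
by move=> uc u0 x y; rewrite /edge R_le M_leE; case: x; case: y => //=; case: u uc u0.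
Qed.

(** Only [u = mc] matters: everything lies below [m0], and any other [u] has no edges, so that its
    structure embeds by means of the isolated vertices [mc], marked, and [m0], unmarked. *)
Lemma R_entails T m : entails cedge cmark T m <->
  forall u, entails (edge (A := R i j) u) (below u) T m.
Proof.
have nl : ~ forall x, cmark x by move/(_ m0).
have nl' u : u <> m0 -> ~ forall x, below (A := R i j) u x.
  by move=> u0 /(_ m0)/R_le; rewrite M_leE; case: u u0.
split=> [h u|/(_ mc)]; last first.
  apply: (@lifting_entails _ _ _ _ _ _ [set id]); split=> //; last exact: nl'.
  - by move=> _ x y -> /edge_mc.
  - by move=> _ x -> /below_mc.
  - by move=> x y /(_ _ erefl)/edge_mc.
  - by move=> x /(_ _ erefl)/below_mc.
  - by exists id.
have [->|u0] := EM (u = m0).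
  move=> v _; apply: top_sat => [|x]; first exact: edge_graph R_base _.
  exact/R_le/M_le0.
have [->|uc] := EM (u = mc).
  move: h; apply: (@lifting_entails _ _ _ _ _ _ [set id]); split=> //; last exact: nl'.
  - by move=> _ x y -> /edge_mc.
  - by move=> _ x -> /below_mc.
  - by move=> x y /(_ _ erefl)/edge_mc.
  - by move=> x /(_ _ erefl)/below_mc.
  - by exists id.
move: h; apply: lifting_entails; apply: (@edgeless_lifting _ _ _ _ _ _ mc m0) => //.
- exact: edge_other.
- exact: nl'.
Qed.

Lemma R_satisfies (t s : term) : satisfies (R i j) (t, s) <->
  (forall m, mons s m -> entails cedge cmark (mons t) m) /\
  (forall m, mons t m -> entails cedge cmark (mons s) m).
Proof.
rewrite (satisfies_entails R_base); split=> [h|[h1 h2] u].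
  by split=> m mm; apply/R_entails => u; apply h.
by split=> m mm; apply: (iffLR (R_entails _ _)); [exact: h1|exact: h2].
Qed.

Lemma R_satisfies_ineq s m : s <> [::] ->
  satisfies (R i j) (ineq s m) <-> entails_seq cedge cmark s m.
Proof.
move=> s0; rewrite (satisfies_ineq R_base _ s0) entails_seqE R_entails.
by split=> h u; have := h u; rewrite entails_seqE.
Qed.

End ConcreteStructure.

(** * Transfer of identities from [R i j] to graph algebras *)

Fixpoint width (t : term) : nat :=
  match t with
  | Var n => n.+1
  | Add t1 t2 | Mul t1 t2 => maxn (width t1) (width t2)
  end.

Definition mono_below (N : nat) (m : mono) : bool :=
  match m with Lm i => i < N | Qm i j => (i < N) && (j < N) | Zm => true end.

Lemma mono_below_width N t m : width t <= N -> mons t m -> mono_below N m.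
Proof.
elim: t m => [n|t1 IH1 t2 IH2|t1 IH1 t2 IH2] m /=; first by move=> nN ->.
  by rewrite geq_max => /andP[w1 w2] [/(IH1 _ w1)|/(IH2 _ w2)].
rewrite geq_max => /andP[w1 w2] [m1 [m2 [/(IH1 _ w1) h1 /(IH2 _ w2) h2 ->]]].
by case: m1 h1 => //= a aN; case: m2 h2 => //= b bN; rewrite aN.
Qed.

(** Again only the element [Gc] needs examination. The bound [N] serves the odd cycles, where few
    variables must miss a vertex. *)
Lemma graph_satisfies (V : Type) (e : V -> V -> Prop) (l : V -> Prop) i j N t s :
  (forall x y, e x y -> e y x) -> (forall x, ~ e x x) ->
  width t <= N -> width s <= N -> satisfies (R i j) (t, s) ->
  (forall T m, (forall m', T m' -> mono_below N m') -> mono_below N m ->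
     entails cedge (cmark i j) T m ->
     entails (edge (A := graph_algebra e l) (Gc V))
             (below (A := graph_algebra e l) (Gc V)) T m) ->
  satisfies (graph_algebra e l) (t, s).
Proof.
move=> eC eirr wt ws /R_satisfies[ts st] hc.
have bg := graph_algebra_base l eC eirr.
have {}hc T m u : (forall m', T m' -> mono_below N m') -> mono_below N m ->
    entails cedge (cmark i j) T m ->
    entails (edge (A := graph_algebra e l) u) (below (A := graph_algebra e l) u) T m.
  move=> Tb mb Tm; case: u => [||A]; last 1 first.
  - move: Tm; apply: lifting_entails; apply: (@edgeless_lifting _ _ _ _ _ _ mc m0) => //.
    + exact: edge_s.
    + by move/(_ (G0 V)).
  - by move=> v _; apply: top_sat; [exact: edge_graph|exact: top_0].
  - exact: hc.
apply/(satisfies_entails bg) => u; split=> m mm; apply: hc.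
- by move=> m'; exact: mono_below_width.
- exact: mono_below_width mm.
- exact: ts.
- by move=> m'; exact: mono_below_width.
- exact: mono_below_width mm.
- exact: st.
Qed.

Lemma model_satisfies marks i j F t :
  lifting (pedge (five_edge true)) (pmark (five_mark marks)) cedge (cmark i j) F ->
  satisfies (R i j) t -> satisfies (model true marks) t.
Proof.
case: t => t s L ts.
apply: (graph_satisfies (N := maxn (width t) (width s)) _ _ _ _ ts).
- by move=> x y; exact: five_edgeC.
- by move=> x; exact: five_edge_irr.
- exact: leq_maxl.
- exact: leq_maxr.
move=> T m _ _ h; apply: (lifting_entails (@graph_lifting _ _ _ _)).
  by move=> x; exact: five_edge_irr.
exact: (lifting_entails L h).
Qed.

Definition five_map (a a' b c d : M) (x : pointed five) : M :=
  match x with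
  | P0 => m0 | Pc => mc
  | Pv va => a | Pv va' => a' | Pv vb => b | Pv vc => c | Pv vd => d
  end.

Definition pair_of (X : Type) (f g : X) : set X := [set h | h = f \/ h = g].

Lemma lifting_pair marks i j f g :
  let F := pair_of f g in
  (forall x y, pedge (five_edge true) x y =
     cedge (f x) (f y) && cedge (g x) (g y) :> Prop) ->
  (forall x, pmark (five_mark marks) x =
     cmark i j (f x) && cmark i j (g x) :> Prop) ->
  lifting (pedge (five_edge true)) (pmark (five_mark marks)) cedge (cmark i j) F.
Proof.
move=> F he hl; split.
- by move=> h x y [] ->; rewrite he => /andP[].
- by move=> h x [] ->; rewrite hl => /andP[].
- by move=> x y h; rewrite he; apply/andP; split; apply: h; [left|right].
- by move=> x h; rewrite hl; apply/andP; split; apply: h; [left|right].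
- by exists f; left.
- by move/(_ P0).
- by move/(_ m0).
Qed.

(** [f] and [g] place the edge [vc vd] in opposite directions, so no pair across the components is
    an edge under both; [mp] removes the mark of [va']. As [mq] is not a value on vertices, all
    [j > 0] behave alike. *)
Lemma model_R1 j t : 0 < j -> satisfies (R 1 j) t ->
  satisfies (model true [:: true; false; true; true; true]) t.
Proof.
move=> j0; apply: model_satisfies (lifting_pair
  (f := five_map ma mp mb ma mb) (g := five_map ma ma mb mb ma) _ _).
- by case=> [||[]] [||[]] //=; apply/propext; split.
- by case: j j0 => // j _; case=> [||[]] //=; apply/propext; split.
Qed.

Lemma model_R01 t : satisfies (R 0 1) t ->
  satisfies (model true [:: true; false; false; false; false]) t.
Proof.
apply: model_satisfies (lifting_pair
  (f := five_map mb mq ma ma mb) (g := five_map mb mq ma mb ma) _ _).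
- by case=> [||[]] [||[]] //=; apply/propext; split.
- by case=> [||[]] //=; apply/propext; split.
Qed.

(** The nonadjacent pair [mp], [mq] keeps the components apart: [f] uses it between [va], [va'] and
    [vd], and [g] between [vb] and [vc]. *)
Lemma model_R02 t : satisfies (R 0 2) t ->
  satisfies (model true [:: true; true; false; true; false]) t.
Proof.
apply: model_satisfies (lifting_pair
  (f := five_map mq mq ma mb mp) (g := five_map mb mb mp mq ma) _ _).
- by case=> [||[]] [||[]] //=; apply/propext; split.
- by case=> [||[]] //=; apply/propext; split.
Qed.

Lemma SR6_satisfies i j t : i <= 1 -> satisfies (R i j) t -> satisfies SR6 t.
Proof.
case: t => t s i1 /R_satisfies[ts st].
(* [fold] and [flip] preserve edges and send one side or the other to [mp], unmarked as [i <= 1]; so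
   they erase all marks except that of [mc]. *)
pose flip x := match x with ma | mp => mb | mb | mq => mp | x => x end.
pose fold x := match x with ma | mp => mp | mb | mq => mb | x => x end.
have p_unmarked : cmark i j mp = false by clear -i1; case: i i1 => [|[]].
have L : lifting cedge (cmark 0 0) cedge (cmark i j)
    [set f | [\/ f = id, f = fold | f = flip]].
  split.
  - by move=> f x y [] ->; case: x; case: y.
  - by move=> f x [] ->; case: x.
  - move=> x y h; have := h id; have := h fold; rewrite /=.
    by move=> /(_ (Or32 _ _ erefl)) + /(_ (Or31 _ _ erefl)).
  - move=> x h; have := h id (Or31 _ _ erefl); have := h fold (Or32 _ _ erefl).
    have := h flip (Or33 _ _ erefl).
    by case: x {h} => //=; rewrite p_unmarked.
  - by exists id; constructor 1.
  - by move/(_ m0).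
  - by move/(_ m0).
by apply/R_satisfies; split=> m mm; apply: (lifting_entails L); [exact: ts|exact: st].
Qed.

(** These two rules hold in [R i j] for [i <= 1]: the graph of [M] is bipartite, and its only
    nonadjacent pair across the two sides is [mp], [mq], where [mp] is unmarked. *)
Definition triangle_rule : seq mono * mono := ([:: Qm 0 1; Qm 1 2; Qm 2 0], Zm).
Definition marked_square_rule : seq mono * mono :=
  ([:: Qm 0 1; Qm 2 1; Qm 2 3; Lm 0; Lm 3], Qm 0 3).

(* A refutation [v] in [SR6] of the rule [T => m] is turned into an assignment in
   the structure by mapping the path [mp - mb - ma - mq] to a given path. *)
Lemma square_of_refutation (X : Type) (e : X -> X -> Prop) (l : X -> Prop) T m :
  graph_with_marks e l ->
  (forall x y z, e x y -> e y z -> e z x -> forall w, l w) ->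
  (forall x1 y2 x2 y1, e x1 y2 -> e x2 y2 -> e x2 y1 -> l x1 -> l y1 -> e x1 y1) ->
  ~ entails cedge (cmark 0 0) T m -> entails e l T m -> square_closed e.
Proof.
move=> g tri msq nTm Tm.
have [v [Tv nmv]] : exists v, (forall m', T m' -> sat cedge (cmark 0 0) v m') /\
    ~ sat cedge (cmark 0 0) v m.
  by apply: contrapT => h; apply: nTm => v Tv; apply: contrapT => nmv; apply: h; exists v.
pose val (x1 y2 x2 y1 c w : X) (z : M) :=
  match z with ma => x2 | mb => y2 | mp => x1 | mq => y1 | mc => c | m0 => w end.
have key x1 y2 x2 y1 c w : e x1 y2 -> e x2 y2 -> e x2 y1 -> l c ->
    sat e l (val x1 y2 x2 y1 c w \o v) m.
  move=> e12 e22 e21 lc; have es := edge_sym g.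
  apply: Tm => -[a|a b|] /Tv /=; last by move/(_ m0).
    by case: (v a).
  by case: (v a); case: (v b) => //= _; auto.
move=> x1 y2 x2 y1 e12 e22 e21.
have [c lc iso] := edge_isolated g e12; have es := edge_sym g.
have from_top : (forall w, l w) -> e x1 y1 by move/(edge_top g).
case: m nTm Tm nmv key => [a|a b|] nTm Tm nmv key; last first.
- by apply: from_top; exact: (key x1 y2 x2 y1 c c).
{ have /= := key x1 y2 x2 y1 c c e12 e22 e21 lc; move: nmv => /=.
  case: (v a); case: (v b) => //= _ h.
  all: try solve [exact: h|exact: es h].
  all: apply: from_top.
  all: try solve [exact: iso h|exact: iso (es _ _ h)|exact: (edge_loop g h)].
  (* The remaining pairs are on one side of the path and have a common neighbour, so [h] closes a
     triangle. *)
  - exact: (tri _ _ _ h e22 (es _ _ e12)).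
  - exact: (tri _ _ _ h (es _ _ e22) e21).
  - exact: (tri _ _ _ h e12 (es _ _ e22)).
  - exact: (tri _ _ _ h (es _ _ e21) e22). }
(* For linear [m] the path is folded onto one edge in both directions; whichever vertex [v a] is,
   one of them marks [x]. The rule for squares with marked ends then applies. *)
have edge_marked x y : e x y -> l x.
  move=> exy; have [d ld _] := edge_isolated g exy.
  have /= := key x y x y d x exy exy exy ld.
  have /= := key y x y x d x (es _ _ exy) (es _ _ exy) (es _ _ exy) ld.
  by move: nmv => /=; case: (v a).
by apply: (msq _ _ _ _ e12 e22 e21);
  [exact: edge_marked e12|exact: edge_marked (es _ _ e21)].
Qed.

Lemma generated_satisfies S A t :
  generated_variety S A -> satisfies S t -> satisfies A t.
Proof. by rewrite generated_varietyE => h St; apply: h => _ ->. Qed.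

Lemma in_generated S A :
  (forall t, satisfies S t -> satisfies A t) -> generated_variety S A.
Proof. by rewrite generated_varietyE => h t tS; apply: h; exact: tS. Qed.

Lemma generated_min S K : is_variety K -> K S -> generated_variety S `<=` K.
Proof. by move=> Kvar KS A; apply; split=> // _ ->. Qed.

Lemma generated_is_variety S : is_variety (generated_variety S).
Proof. by rewrite generated_varietyE; exact: models_variety. Qed.

(** * Subvarieties that omit [SR6] *)

Section Subvarieties.
Variables i j : nat.
Hypothesis i1 : i <= 1.

Let V := generated_variety (R i j).

Lemma generated_base A : V A -> base A.
Proof.
move=> VA; apply/base_axiomP => k k7; apply: (generated_satisfies VA).
exact: (iffLR (base_axiomP _) (R_base i j)).
Qed.

Let p_unmarked : cmark i j mp = false.
Proof. by case: i i1 => [|[]]. Qed.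

Lemma generated_rule A s m : V A -> s <> [::] ->
  entails_seq cedge (cmark i j) s m ->
  forall u : A, entails_seq (edge u) (below u) s m.
Proof.
move=> VA s0 h; apply/(satisfies_ineq (generated_base VA) _ s0).
by apply: (generated_satisfies VA); apply/R_satisfies_ineq.
Qed.

Lemma generated_triangle (A : algebra) (u x y z : A) : V A ->
  edge u x y -> edge u y z -> edge u z x -> forall w, below u w.
Proof.
move=> VA xy yz zx.
have rule : entails_seq cedge (cmark i j) triangle_rule.1 Zm.
  by move=> v /= [+ [+ [+ _]]]; case: (v 0); case: (v 1) => //; case: (v 2).
by have /= := generated_rule VA _ rule (u := u) (v := assign x y z x x); apply.
Qed.

Lemma generated_marked_square (A : algebra) (u x1 y2 x2 y1 : A) : V A ->
  edge u x1 y2 -> edge u x2 y2 -> edge u x2 y1 -> below u x1 -> below u y1 ->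
  edge u x1 y1.
Proof.
move=> VA e1 e2 e3 l1 l2.
have rule : entails_seq cedge (cmark i j) marked_square_rule.1 (Qm 0 3).
  move=> v /= [+ [+ [+ [+ [+ _]]]]].
  by case: (v 0); case: (v 1) => //; case: (v 2) => //; case: (v 3) => //;
    rewrite p_unmarked.
by have /= := generated_rule VA _ rule (u := u) (v := assign x1 y2 x2 y1 x1); apply.
Qed.

(** By Birkhoff's theorem an identity of [W] fails in [SR6]; one of its rules fails there, and
    [square_of_refutation] applies to it. *)
Lemma subvariety_square (W : set algebra) :
  subvarieties V W -> ~ W SR6 -> W `<=` models square_axioms.
Proof.
move=> [Wvar WV] nW A WA; apply/square_axiomsP.
split; first exact: generated_base (WV _ WA).
have [[t s] eW eS] : exists2 i, identities W i & ~ satisfies SR6 i.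
  apply: contrapT => h; apply: nW; rewrite (Birkhoff Wvar) => k kW.
  by apply: contrapT => nk; apply: h; exists k.
move=> u; have VA := WV _ WA; have bA := generated_base VA.
have g := edge_graph bA u.
have {eW} := (satisfies_entails bA t s).1 (eW _ WA) u.
have sq T m : ~ entails cedge (cmark 0 0) T m -> entails (edge u) (below u) T m ->
    square_closed (edge u).
  apply: square_of_refutation g _ _ => [x y z|x1 y2 x2 y1].
    exact: generated_triangle.
  exact: generated_marked_square.
move=> [ts st]; apply: contrapT => nsq; apply: eS; apply/R_satisfies; split=> m mm.
  by apply: contrapT => /sq; apply: contra_not nsq; apply; exact: ts.
by apply: contrapT => /sq; apply: contra_not nsq; apply; exact: st.
Qed.

Lemma SR6_generated : generated_variety SR6 `<=` V.
Proof.
apply: generated_min; first exact: generated_is_variety.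
by apply: in_generated => t; exact: SR6_satisfies.
Qed.

End Subvarieties.

(** * Odd cycles *)

Section OddCycle.
Variable n : nat.
Hypothesis n0 : 0 < n.

(* The vertices above [n.*2] are isolated. *)
Definition cycle_edge (x y : nat) : bool :=
  [|| (y == x.+1) && (y <= n.*2), (x == y.+1) && (x <= n.*2),
      (x == 0) && (y == n.*2) | (y == 0) && (x == n.*2)].

Definition cycle_algebra : algebra := graph_algebra cycle_edge (fun=> False).

Definition odd_cycle : seq mono := Qm n.*2 0 :: [seq Qm k k.+1 | k <- iota 0 n.*2].

Lemma sat_all_map X (e : X -> X -> Prop) l v (f : nat -> mono) s :
  sat_all e l v [seq f k | k <- s] <-> forall k, k \in s -> sat e l v (f k).
Proof.
elim: s => [|k s IH] /=; first by split.
rewrite IH; split=> [[fk fs] k'|h]; first by rewrite in_cons => /predU1P[->//|]; exact: fs.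
by split=> [|k' k's]; apply: h; rewrite in_cons ?eqxx// k's orbT.
Qed.

Lemma cycle_edgeC x y : cycle_edge x y -> cycle_edge y x.
Proof. by rewrite /cycle_edge => /or4P[] ->; rewrite ?orbT. Qed.

Lemma cycle_edge_irr x : ~ cycle_edge x x.
Proof. by rewrite /cycle_edge; lia. Qed.

Let eC : forall x y, cycle_edge x y -> cycle_edge y x := cycle_edgeC.
Let eirr : forall x, ~ cycle_edge x x := cycle_edge_irr.

Lemma cycle_algebra_odd_cycle : ~ satisfies cycle_algebra (ineq odd_cycle Zm).
Proof.
have bC := graph_algebra_base (fun=> False) eC eirr.
have ne : odd_cycle <> [::] by [].
move=> /(satisfies_ineq bC _ ne)/(_ (Gc nat))/entails_seqE h.
have {h} := lifting_entails (embed_lifting cycle_edge (fun=> False)) h.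
move=> /entails_seqE /(_ (@Pv nat)) h.
suff sat_cycle : sat_all (pedge cycle_edge) (pmark (fun=> False)) (@Pv nat) odd_cycle.
  exact: (h sat_cycle P0).
have closing : cycle_edge n.*2 0 by rewrite /cycle_edge; lia.
split=> //; apply/sat_all_map => k; rewrite mem_iota => k2.
by change (is_true (cycle_edge k k.+1)); rewrite /cycle_edge; lia.
Qed.

Section MissingVertex.
Variable j0 : nat.
Hypothesis j0n : j0 <= n.*2.

(** The two-coloring of the path left after deleting [j0]. Parities are swapped beyond [j0] because
    the closing edge joins the even vertices 0 and 2n. *)
Definition side (x : nat) : bool := if x < j0 then odd x else ~~ odd x.

Lemma cycle_side x y : x <> j0 -> y <> j0 -> cycle_edge x y -> side y = ~~ side x.
Proof. by rewrite /cycle_edge /side; case: ifP; case: ifP; lia. Qed.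

(** [j1] and [j2] go to the ends of the path [mp - mb - ma - mq] and all other vertices to its
    middle, so that the nonedge [j1 j2] stays a nonedge while edges are preserved. *)
Definition cycle_map (j1 j2 : nat) (x : pointed nat) : M :=
  match x with
  | P0 => m0
  | Pc => mc
  | Pv x => if side x then if (x == j1) || (x == j2) then mp else ma
            else if (x == j1) || (x == j2) then mq else mb
  end.

Let X := {x : pointed nat | x <> Pv j0}.

Lemma cycle_lifting :
  lifting (fun x y : X => pedge cycle_edge (sval x) (sval y))
    (fun x : X => pmark (fun=> False) (sval x)) cedge (cmark 0 0)
    [set f | exists j1 j2, ~~ cycle_edge j1 j2 /\ f = cycle_map j1 j2 \o sval].
Proof.
have irr x : ~~ cycle_edge x x by apply/negP/cycle_edge_irr.
have f00 : exists j1 j2, ~~ cycle_edge j1 j2 /\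
    cycle_map 0 0 \o sval = cycle_map j1 j2 \o (sval : X -> _).
  by exists 0, 0.
split.
- move=> _ [[||x] xj] [[||y] yj] [j1 [j2 [nj ->]]] //= xy.
  rewrite (cycle_side _ _ xy);
    [|by move=> E; apply: xj; rewrite E|by move=> E; apply: yj; rewrite E].
  have both : ((x == j1) || (x == j2)) && ((y == j1) || (y == j2)) = false.
    apply/negP => /andP[/orP[] /eqP xE /orP[] /eqP yE]; move: nj xy; rewrite xE yE.
    + by move=> _ /eirr.
    + by move=> /negP nj' /nj'.
    + by move=> /negP nj' /eC/nj'.
    + by move=> _ /eirr.
  by move: both; case: (side x); case: (_ || _) => //=; case: (_ || _).
- by move=> _ [[||x] xj] [j1 [j2 [nj ->]]].
- move=> [[||x] xj] [[||y] yj] /= h; try by have := h _ f00; rewrite /=; do ?case: ifP.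
  case: (boolP (cycle_edge x y)) => // nxy.
  have : exists j1 j2, ~~ cycle_edge j1 j2 /\
      cycle_map x y \o sval = cycle_map j1 j2 \o (sval : X -> _).
    by exists x, y.
  move/h => /=; rewrite !eqxx !orbT.
  by case: (side x); case: (side y).
- move=> [[||x] xj] /= h //; have := h _ f00; rewrite //=.
  by do ?case: ifP.
- by exists (cycle_map 0 0 \o sval).
- by have n0j : @P0 nat <> Pv j0 by []; move/(_ (exist (fun x => x <> Pv j0) _ n0j)).
- by move/(_ m0).
Qed.

End MissingVertex.

Lemma missing_vertex (v : nat -> pointed nat) : (forall w, n <= w -> v w = Pc) ->
  exists2 j0, j0 <= n.*2 & forall w, v w <> Pv j0.
Proof.
move=> vc; pose vertices := [seq if v w is Pv a then a else 0 | w <- iota 0 n].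
have /allPn[j0] : ~~ all [in vertices] (iota 0 n.*2.+1).
  apply/negP => /allP sub; have := uniq_leq_size (iota_uniq 0 n.*2.+1) sub.
  by rewrite size_map !size_iota; lia.
rewrite mem_iota => j0n jv; exists j0; first by lia.
move=> w vw; case: (leqP n w) => [/vc|wn]; first by rewrite vw.
by case/negP: jv; apply/mapP; exists w; rewrite ?mem_iota// vw.
Qed.

Lemma sat_below X (e : X -> X -> Prop) l (v v' : nat -> X) m :
  (forall w, w < n -> v w = v' w) -> mono_below n m -> sat e l v m -> sat e l v' m.
Proof.
move=> vv'; case: m => //= [a /vv' -> //|a b /andP[/vv' -> /vv' ->] //].
Qed.

Lemma cycle_algebra_satisfies t s : width t <= n -> width s <= n ->
  satisfies SR6 (t, s) -> satisfies cycle_algebra (t, s).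
Proof.
move=> wt ws ts; apply: (graph_satisfies eC eirr wt ws ts) => T m Tn mn Tm v Tv.
(* Variables from [n] on are moved to [Gc], which no selection sends to a vertex; the other [n]
   cannot cover the 2n+1 vertices of the cycle. *)
pose v' w := if w < n then v w else Gc nat.
have vv' w : w < n -> v w = v' w by move=> wn; rewrite /v' wn.
apply: (sat_below (v := v')) mn _ => [w /vv'//|].
have {}Tv m' : T m' -> sat (edge (A := cycle_algebra) (Gc nat))
    (below (A := cycle_algebra) (Gc nat)) v' m'.
  by move=> Tm'; apply: sat_below vv' (Tn _ Tm') (Tv _ Tm').
have L := @graph_lifting _ cycle_edge (fun=> False) eirr.
apply: (lifting_reflect L) => f sf.
have {}Tv m' : T m' -> sat (pedge cycle_edge) (pmark (fun=> False)) (f \o v') m'.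
  by move/Tv; exact: (lifting_sat L sf).
have [j0 j0n nj] : exists2 j0, j0 <= n.*2 & forall w, (f \o v') w <> Pv j0.
  by apply: missing_vertex => w nw; case: sf => _ fc _; rewrite /= /v' ltnNge nw.
have := lifting_entails (cycle_lifting j0n) Tm
  (v := fun w => exist (fun x => x <> Pv j0) _ (nj w)).
have satE m' : sat (fun x y : {x | x <> Pv j0} => pedge cycle_edge (sval x) (sval y))
    (fun x : {x | x <> Pv j0} => pmark (fun=> False) (sval x))
    (fun w => exist (fun x => x <> Pv j0) _ (nj w)) m' <->
    sat (pedge cycle_edge) (pmark (fun=> False)) (f \o v') m'.
  case: m' => //=; split=> h; last by case: (h P0).
  by have n0j : @P0 nat <> Pv j0 by []; case: (h (exist (fun x => x <> Pv j0) _ n0j)).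
by move=> h; apply/satE; apply: h => m' /Tv /satE.
Qed.

(** The premise never holds, the graph of [M] being bipartite with sides {[ma], [mp]} and {[mb],
    [mq]}. *)
Lemma R_odd_cycle i j : satisfies (R i j) (ineq odd_cycle Zm).
Proof.
apply/R_satisfies_ineq => // v [vn /sat_all_map vk]; exfalso.
pose s x := match x with ma | mp => true | _ => false end.
have sE x y : cedge x y -> s y = ~~ s x by case: x; case: y.
have sk k : k <= n.*2 -> s (v k) = s (v 0) (+) odd k.
  elim: k => [_|k IH k2]; first by rewrite addbF.
  by rewrite (sE (v k)) ?IH ?addbN//; [exact: ltnW|apply: (vk k); rewrite mem_iota].
by have := sE _ _ vn; rewrite (sk n.*2)// odd_double addbF; case: (s _).
Qed.

End OddCycle.

Lemma finite_width (E : set identity) : finite_set E ->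
  exists n, forall i, E i -> width i.1 <= n /\ width i.2 <= n.
Proof.
move=> finE; pose f (i : identity) := maxn (width i.1) (width i.2).
have /finite_seqP[s sE] : finite_set (f @` E) by exact: finite_image.
exists (\max_(k <- s) k) => i Ei.
have : f i \in s by have : (f @` E) (f i) by [exists i]; rewrite sE.
move=> /(@leq_bigmax_seq _ _ predT id) /(_ isT).
by rewrite geq_max => /andP[].
Qed.

(** * Subvarieties of the variety of [R i j] *)

Section MainResults.
Variables i j : nat.
Hypothesis i1 : i <= 1.

Let V := generated_variety (R i j).

(** The algebra of a long odd cycle satisfies any given finite basis of [W] and would lie in [V],
    which it does not by the identity [ineq (odd_cycle n) Zm]. *)
Lemma nonfinitely_based (W : set algebra) :
  W `<=` V -> is_variety W -> W SR6 -> ~ finitely_based W.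
Proof.
move=> WV Wvar WS [E finE WE]; have [n0 nE] := finite_width finE.
pose n := n0.+1.
have WC : W (cycle_algebra n).
  rewrite WE => -[t s] Ets; have [/= wt ws] := nE _ Ets.
  apply: cycle_algebra_satisfies => //; try exact: leq_trans (leqnSn _).
  by move: WS; rewrite WE; apply.
apply: (@cycle_algebra_odd_cycle n) => //.
exact: (generated_satisfies (WV _ WC) (@R_odd_cycle _ _ _)).
Qed.

Lemma finitely_basedP (W : set algebra) :
  subvarieties V W -> finitely_based W <-> ~ W SR6.
Proof.
move=> sW; have [Wvar WV] := sW; split=> [fW WS|nW].
  exact: (nonfinitely_based WV Wvar WS).
exact: subvariety_finitely_based (subvariety_square i1 sW nW).
Qed.

(** The nonfinitely based subvarieties are those containing [SR6]; they have a least one, which is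
    therefore the only minimal one. *)
Lemma limit_subvarieties_eq :
  limit_subvarieties V = [set generated_variety SR6].
Proof.
have Lvar := generated_is_variety SR6.
have LV := SR6_generated i1 (j := j).
have LS : generated_variety SR6 SR6 by move=> K [_]; apply.
have nfL : ~ finitely_based (generated_variety SR6) by exact: nonfinitely_based.
apply/seteqP; split=> [W [sW [Wvar nW minW]]|_ ->]; last first.
  do 2?split=> //; move=> W [Wvar WL] [_ nLW].
  apply/finitely_basedP; first by split=> // A /WL; exact: LV.
  by move=> WS; apply: nLW; exact: generated_min.
have WS : W SR6 by apply: contrapT => /(finitely_basedP sW).
have LW : generated_variety SR6 `<=` W by exact: generated_min.
apply: contrapT => WL; apply: nfL; apply: minW; first by split.
split=> // WL'; apply: WL; exact/seteqP.
Qed.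

(* The rules [c] are those valid in [R i j]; modulo the square axioms, they
   axiomatize the variety generated by a model lying in [V]. *)
Variables (c : seq nat) (r : bitseq) (d : bool * bitseq).
Hypotheses (c10 : all (fun k => k < 10) c).
Hypothesis R_test : forall k, k \in c -> satisfies (R i j) (test k).
Hypothesis rd : (r, d) \in model_table.
Hypothesis model_R : forall t, satisfies (R i j) t -> satisfies (model_of d) t.
Hypothesis least : all (fun s => all (nth false s) c ==> profile_le r s) closed_profiles.

(** An identity of [R i j] splits into laws. These hold in the model [d], so they belong to its
    profile [r], which is contained in every closed profile containing [c]. *)
Lemma square_in_generated :
  models (square_axioms `|` test @` [set k | k \in c]) `<=` V.
Proof.
move=> A hA; apply: in_generated => t Rt.
have sqA : models square_axioms A by move=> a sa; apply: hA; left.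
have subA : [set A] `<=` models square_axioms by move=> _ ->.
have [D [D10 DP]] := identity_decomposition t.
apply/(DP _ sqA) => k Dk; have k10 := D10 _ Dk.
suff /(profileP _ k10) : nth false (profile [set A]) k by apply.
have /allP/(_ _ (profile_closed subA))/implyP := least.
have cA : all (nth false (profile [set A])) c.
  apply/allP => a ac; apply/profileP; first exact: (allP c10).
  by move=> _ ->; apply: hA; right; exists a.
move=> /(_ cA)/allP/(_ k); rewrite mem_iota k10 => /(_ isT)/implyP; apply.
rewrite -(model_tableP rd); apply/profileP => // _ ->.
by apply: (iffLR (DP _ _)) Dk; [exact: model_square|exact: model_R].
Qed.

Lemma fb_subvarieties_eq : fb_subvarieties V =
  [set W | is_variety W /\
     W `<=` models (square_axioms `|` test @` [set k | k \in c])].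
Proof.
apply/seteqP; split=> W /= [].
  move=> sW /(finitely_basedP sW) nW; split; first exact: sW.1.
  move=> A WA a [|[k kc <-]]; first exact: (subvariety_square i1 sW nW WA).
  by apply: (generated_satisfies (sW.2 _ WA)); exact: R_test.
move=> Wvar Wsub; split; first by split=> // A /Wsub; exact: square_in_generated.
apply: subvariety_finitely_based => // A /Wsub hA a sa.
by apply: hA; left.
Qed.

End MainResults.

Lemma card_fb_subvarieties i j c n r d : i <= 1 ->
  all (fun k => k < 10) c ->
  (forall k, k \in c -> satisfies (R i j) (test k)) ->
  (r, d) \in model_table ->
  (forall t, satisfies (R i j) t -> satisfies (model_of d) t) ->
  all (fun s => all (nth false s) c ==> profile_le r s) closed_profiles ->
  size [seq s <- closed_profiles | all (nth false s) c] = n ->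
  fb_subvarieties (generated_variety (R i j)) #= `I_n.
Proof.
move=> i1 c10 Rc rd dR least <-.
by rewrite (fb_subvarieties_eq i1 c10 Rc rd dR least) card_subvarieties.
Qed.

Lemma R_test i j k : law cedge (cmark i j) k -> satisfies (R i j) (test k).
Proof.
by move=> h; apply/R_satisfies_ineq; [exact: law_rule_neq0|exact/law_ruleP].
Qed.

(** No law holds in [R 1 j], as its variety contains the model with empty profile; so all closed
    profiles count. *)
Lemma card_fb_R1 j : 0 < j -> fb_subvarieties (generated_variety (R 1 j)) #= `I_18.
Proof.
move=> j0; apply: (@card_fb_subvarieties 1 j [::] _ (profile_of [::])
  (true, [:: true; false; true; true; true])) => //.
by move=> t; exact: model_R1.
Qed.

Lemma card_fb_R01 : fb_subvarieties (generated_variety (R 0 1)) #= `I_5.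
Proof.
apply: (@card_fb_subvarieties 0 1 [:: 5] _ (profile_of [:: 4; 5; 6; 7; 8; 9])
  (true, [:: true; false; false; false; false])) => //.
(* [mb] is the only marked vertex on an edge, so [x] and [u] coincide. *)
- move=> k; rewrite inE => /eqP ->; apply: R_test => x y u v.
  by case: x; case: y => // _; case: u; case: v.
- exact: model_R01.
Qed.

Lemma card_fb_R02 : fb_subvarieties (generated_variety (R 0 2)) #= `I_5.
Proof.
apply: (@card_fb_subvarieties 0 2 [:: 2; 9] _ (profile_of [:: 2; 4; 6; 7; 8; 9])
  (true, [:: true; true; false; true; false])) => //.
(* The marked vertices on edges are [mb] and [mq], which form one entire side. *)
- move=> k; rewrite !inE => /orP[] /eqP ->; apply: R_test => x y; last by case: x; case: y.
  by move=> z; case: x; case: y => //; case: z.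
- exact: model_R02.
Qed.

Theorem corollary9p3 :
  [/\ fb_subvarieties (generated_variety (R 1 2)) #= `I_18,
      (forall W : set algebra, subvarieties (generated_variety (R 1 2)) W ->
         ~ fb_subvarieties (generated_variety (R 1 2)) W ->
         ~ finitely_based W),
      limit_subvarieties (generated_variety (R 1 2)) =
        [set generated_variety SR6],
      [/\ fb_subvarieties (generated_variety (R 0 1)) #= `I_5,
          fb_subvarieties (generated_variety (R 0 2)) #= `I_5 &
          fb_subvarieties (generated_variety (R 1 1)) #= `I_18] &
      [/\ limit_subvarieties (generated_variety (R 0 1)) =
            [set generated_variety SR6],
          limit_subvarieties (generated_variety (R 0 2)) =
            [set generated_variety SR6] &
          limit_subvarieties (generated_variety (R 1 1)) =
            [set generated_variety SR6]]].
Proof.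
split; [exact: card_fb_R1| |exact: limit_subvarieties_eq| |].
- by move=> W sW nW fW; apply: nW; split.
- by split; [exact: card_fb_R01|exact: card_fb_R02|exact: card_fb_R1].
- by split; exact: limit_subvarieties_eq.
Qed.
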